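(* Let $X=T(\mathcal{F}_0,(\theta_n,\mathcal{F}_n)_{n=1}^\infty)$ where $(\mathcal{F}_n)_{n\ge0}$ are regular families with $\mathcal{S}_0\subseteq\mathcal{F}_n$ for all $n\ge0$, $\bigcup_n\mathcal{F}_n$ regular, $(\theta_n)$ nonincreasing null in $(0,1)$, $\alpha_n=\iota(\mathcal{F}_n)$ with $\alpha_n>1$ for $n\ge1$ and $(\alpha_n)_{n\ge1}$ nondecreasing. Suppose $\alpha=\sup_{n\in\mathbb{N}}\alpha_n=\omega^{\omega^\xi}$ for some countable ordinal $\xi\ne0$, and $\alpha_n<\alpha$ for all $n\in\mathbb{N}\cup\{0\}$. For $\varepsilon>0$ and $m\in\mathbb{N}$ let $$\gamma(\varepsilon,m)=\max\{\ell(\alpha_0\cdot\alpha_{n_s}\cdots\alpha_{n_1}): s,n_1,\dots,n_s\in\mathbb{N},\ \varepsilon\theta_{n_1}\theta_{n_2}\cdots\theta_{n_s}>\theta_m\}\quad(\max\emptyset=0).$$ If there exists $\varepsilon>0$ such that for every $\beta<\omega^\xi$ there exists $m\in\mathbb{N}$ with $\gamma(\varepsilon,m)+2+\beta<\ell(\alpha_m)$, then $I_b(X)=\omega^{\omega^\xi\cdot2}$.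
   Context: Regular family: hereditary, spreading, compact subset of $[\mathbb{N}]^{<\infty}\subseteq 2^{\mathbb{N}}$. $\mathcal{S}_0=\{\{n\}\}\cup\{\emptyset\}$. Mixed Tsirelson space: completion of $c_{00}$ under the norm implicitly defined by $\|x\|=\max\{\|x\|_{\mathcal{F}_0},\sup_n\sup\theta_n\sum_i\|E_ix\|\}$ with $\|\sum a_ke_k\|_{\mathcal{F}}=\sup_{F\in\mathcal{F}}\sum_{k\in F}|a_k|$, $Ex$ the restriction of $x$ to $E$, inner sup over $E_1<\dots<E_k$ with $\{\min E_i\}\in\mathcal{F}_n$. $\iota(\mathcal{F})$: the ordinal $\beta$ with $\mathcal{F}^{(\beta)}=\{\emptyset\}$ (iterated Cantor–Bendixson derived sets). For a countable ordinal $\eta$ with Cantor normal form $\omega^{\gamma_1}k_1+\dots+\omega^{\gamma_p}k_p$ ($\gamma_1>\dots>\gamma_p$), $\ell(\eta)=\gamma_1$. $I_b(E)=\sup_KI_b(E,K)$, $I_b(E,K)$ being the supremum of the orders $o(T)$ of $\ell^1$-$K$ block trees (trees on the unit sphere, closed under initial segments, whose nodes are finite block bases of the unit vector basis with $\|\sum a_ix_i\|\ge K^{-1}\sum|a_i|$); $o(T)$ is the least $\beta$ with $D^\beta(T)=\emptyset$, $D$ removing nodes without proper extensions, iterated transfinitely. *)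

(* Defs.v *)
From HB Require Import structures.
From mathcomp Require Import all_boot all_order all_algebra.
From mathcomp Require Import all_classical all_reals all_analysis.
Set Implicit Arguments. Unset Strict Implicit. Unset Printing Implicit Defensive.
Import Order.TTheory GRing.Theory Num.Theory.
Import numFieldNormedType.Exports.
Local Open Scope classical_set_scope.
Local Open Scope ring_scope.

(* Countable ordinals as Brouwer ordinals (zero, successor, sup of an  *)
(* omega-sequence).  Every countable ordinal is represented.           *)
Inductive Ord : Type :=
| OZ : Ord
| OS : Ord -> Ord
| OL : (nat -> Ord) -> Ord.   (* OL f = sup_n f n *)

Inductive ole : Ord -> Ord -> Prop :=
| ole_zero b : ole OZ b
| ole_succ a b : ole a b -> ole (OS a) (OS b)
| ole_cocone a f n : ole a (f n) -> ole a (OL f)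
| ole_limiting f b : (forall n, ole (f n) b) -> ole (OL f) b.

Definition olt (a b : Ord) : Prop := ole (OS a) b.
Definition oeq (a b : Ord) : Prop := ole a b /\ ole b a.

Fixpoint oadd (a b : Ord) : Ord :=
  match b with
  | OZ => a
  | OS b' => OS (oadd a b')
  | OL f => OL (fun n => oadd a (f n))
  end.

Fixpoint omul (a b : Ord) : Ord :=
  match b with
  | OZ => OZ
  | OS b' => oadd (omul a b') a
  | OL f => OL (fun n => omul a (f n))
  end.

Definition onat (n : nat) : Ord := iter n OS OZ.
Definition oone : Ord := OS OZ.
Definition otwo : Ord := OS (OS OZ).
Definition omega : Ord := OL onat.

Fixpoint opow (b : Ord) : Ord :=
  match b with
  | OZ => oone
  | OS b' => omul (opow b') omega
  | OL f => OL (fun n => opow (f n))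
  end.

(* ell_is eta g : g = ell(eta), the leading exponent of the Cantor normal form
   of eta (eta >= 1), i.e. omega^g <= eta < omega^(g+1). *)
Definition ell_is (eta g : Ord) : Prop := ole (opow g) eta /\ olt eta (opow (OS g)).

Fixpoint oiter {U : Type} (D : set U -> set U) (A : set U) (b : Ord) : set U :=
  match b with
  | OZ => A
  | OS b' => D (oiter D A b')
  | OL f => [set y | forall n, oiter D A (f n) y]
  end.

Definition nfamily := set (set nat).

Definition agree_upto (n : nat) (A B : set nat) : Prop :=
  forall k, (k < n)%N -> (A k <-> B k).

Definition finite_sets (F : nfamily) : Prop := forall A, F A -> finite_set A.
Definition hereditary (F : nfamily) : Prop := forall A B, F A -> B `<=` A -> F B.
Definition spreading (F : nfamily) : Prop :=
  forall A (g : nat -> nat), F A ->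
    (forall a a', A a -> A a' -> (a < a')%N -> (g a < g a')%N) ->
    (forall a, A a -> (a <= g a)%N) -> F (g @` A).
(* compact (= closed, as a subset of the Cantor space 2^N) *)
Definition compact_family (F : nfamily) : Prop :=
  forall B : set nat, (forall n, exists2 A, F A & agree_upto n A B) -> F B.
Definition regular (F : nfamily) : Prop :=
  [/\ finite_sets F, hereditary F, spreading F & compact_family F].

Definition S0 : nfamily := [set A | A = set0 \/ exists n, A = [set n]].

Definition cb_deriv (F : nfamily) : nfamily :=
  [set A | F A /\ forall n, exists B, [/\ F B, B <> A & agree_upto n A B]].

Definition iota_is (F : nfamily) (b : Ord) : Prop :=
  oiter cb_deriv F b = [set set0].

Section MT.
Variable R : realType.

Definition restrict (E : set nat) (x : nat -> R) : nat -> R :=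
  fun k => if k \in E then x k else 0.

Definition normF (F : nfamily) (x : nat -> R) : R :=
  sup [set r | exists2 A, F A & r = (\sum_(k \in A) `|x k|)%R].

Definition is_min_of (E : set nat) (m : nat) : Prop :=
  E m /\ forall k, E k -> (m <= k)%N.
Definition admissible (G : nfamily) (Es : seq (set nat)) : Prop :=
  [/\ (0 < size Es)%N,
      (forall i, (i < size Es)%N -> finite_set (nth set0 Es i) /\ nth set0 Es i <> set0),
      (forall i j a b, (i < j)%N -> (j < size Es)%N ->
          nth set0 Es i a -> nth set0 Es j b -> (a < b)%N) &
      G [set m | exists2 i, (i < size Es)%N & is_min_of (nth set0 Es i) m]].

(* Standard approximating norms |.|_j, increasing in j, whose limit is the
   norm implicitly defined by
   ||x|| = max(||x||_F0, sup_n sup theta_n sum_i ||E_i x||). *)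
Fixpoint mtn (F : nat -> nfamily) (theta : nat -> R) (j : nat) (x : nat -> R) : R :=
  match j with
  | O => normF (F O) x
  | S j' => Num.max (normF (F O) x)
      (sup [set r | exists n Es, [/\ (1 <= n)%N, admissible (F n) Es &
              r = theta n * \sum_(E <- Es) mtn F theta j' (restrict E x)]])
  end.

Definition mt_norm (F : nat -> nfamily) (theta : nat -> R) (x : nat -> R) : R :=
  sup (range (fun j => mtn F theta j x)).

Definition finsupp (x : nat -> R) : Prop := finite_set [set k | x k != 0].

Definition nthv (xs : seq (nat -> R)) (i : nat) : nat -> R := nth (fun=> 0) xs i.

Definition l1K_block (N : (nat -> R) -> R) (K : R) (xs : seq (nat -> R)) : Prop :=
  [/\ (forall i, (i < size xs)%N -> finsupp (nthv xs i) /\ N (nthv xs i) = 1),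
      (forall i j a b, (i < j)%N -> (j < size xs)%N ->
          nthv xs i a != 0 -> nthv xs j b != 0 -> (a < b)%N) &
      (forall a : nat -> R,
          K^-1 * (\sum_(i < size xs) `|a i|) <=
          N (fun k => \sum_(i < size xs) a i * nthv xs i k))].

Definition l1K_tree (N : (nat -> R) -> R) (K : R) (T : set (seq (nat -> R))) : Prop :=
  [/\ (forall t, T t -> (0 < size t)%N),
      (forall t n, T t -> (0 < n)%N -> (n <= size t)%N -> T (take n t)) &
      (forall t, T t -> l1K_block N K t)].

Definition tree_deriv (T : set (seq (nat -> R))) : set (seq (nat -> R)) :=
  [set t | T t /\ exists u, [/\ T u, (size t < size u)%N & take (size t) u = t]].

(* I_b(X) = eta, i.e. sup_K sup_T o(T) = eta, where o(T) <= eta iff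
   D^eta(T) is empty and o(T) > d iff D^d(T) is nonempty. *)
Definition Ib_is (N : (nat -> R) -> R) (eta : Ord) : Prop :=
  (forall K T, 0 < K -> l1K_tree N K T -> oiter tree_deriv T eta = set0) /\
  (forall d, olt d eta ->
     exists K T, [/\ 0 < K, l1K_tree N K T & oiter tree_deriv T d !=set0]).

(* for l = [:: n_1; ...; n_s] : alpha_0 . alpha_{n_s} ... alpha_{n_1} *)
Fixpoint aprod (alpha : nat -> Ord) (l : seq nat) : Ord :=
  match l with
  | [::] => alpha O
  | n :: l' => omul (aprod alpha l') (alpha n)
  end.

Definition gamma_set (alpha : nat -> Ord) (theta : nat -> R) (eps : R) (m : nat)
  (lam : Ord) : Prop :=
  exists l : seq nat, [/\ (0 < size l)%N, all (fun n => (0 < n)%N) l,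
     theta m < eps * \prod_(n <- l) theta n & ell_is (aprod alpha l) lam].

(* g = gamma(eps, m) : the maximum of gamma_set (max of emptyset = 0) *)
Definition gamma_is (alpha : nat -> Ord) (theta : nat -> R) (eps : R) (m : nat)
  (g : Ord) : Prop :=
  (forall lam, gamma_set alpha theta eps m lam -> ole lam g) /\
  (gamma_set alpha theta eps m g \/ ole g OZ).

End MT.

(* Main.v *)
Require Import Defs.
From HB Require Import structures.
From mathcomp Require Import all_boot all_order all_algebra.
From mathcomp Require Import all_classical all_reals all_analysis.
From mathcomp Require Import lra.
Set Implicit Arguments. Unset Strict Implicit. Unset Printing Implicit Defensive.
Import Order.TTheory GRing.Theory Num.Theory.
Import numFieldNormedType.Exports.
Local Open Scope classical_set_scope.
Local Open Scope ring_scope.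

(* Write a = omega^(omega^xi); the claim is that the index equals a * a.
   The norm is the supremum of the pairings <f, |x|> over the set of functionals
   generated by the indicators of sets of F_0 and the operations
   (f_i) |-> theta_n * sum_i f_i restricted to F_n-admissible sets.  The tool
   behind both bounds is an averaging lemma: a tree of order omega^eta carries a
   convex combination along a branch that gives small mass to every member of
   any family of rank below omega^eta.

   Upper bound.  In an l^1-K tree of order a * a one builds averages y_1, y_2, ...
   of blocks, y_i being spread enough to defeat all F_n up to a bound that grows
   rapidly with i, and then averages the y_i against the families obtained by
   composing boundedly many F_n with theta_n not small; these have rank below a.
   For every functional f the set of i with <f, y_i> > C lies in such a family, so
   the final average has norm below 1/K.

   Lower bound.  Let c = theta_m / eps.  The sets {f > c} form a family of rank at
   most a product alpha_0 alpha_(n_s) ... alpha_(n_1) with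
   eps theta_(n_1) ... theta_(n_s) > theta_m, hence below
   omega^(gamma(eps, m) + 1).  Averages of unit vectors defeating this family have
   norm at most 2c and, once normalized, those supported by a common member of F_m
   are equivalent to the l^1 basis with a constant independent of m.  This gives
   trees of order omega^beta for each beta < omega^xi with one constant, and F_n
   glues them to trees of order a * alpha_n. *)

Local Notation filter := seq.filter.

(** * Ordinal arithmetic *)

Lemma olexx a : ole a a.
Proof.
elim: a => [|a IH|f IH]; [exact: ole_zero|exact: ole_succ|].
by apply: ole_limiting => n; apply: ole_cocone (IH n).
Qed.
#[local] Hint Resolve olexx : core.

Lemma ole_OS a b : ole (OS a) (OS b) -> ole a b.
Proof. by move=> h; inversion h. Qed.

Lemma ole_OSn0 a : ~ ole (OS a) OZ.
Proof. by move=> h; inversion h. Qed.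

Lemma ole_OL_inv f b n : ole (OL f) b -> ole (f n) b.
Proof.
elim: b => [|b IH|g IH] h.
- by inversion h.
- by inversion h.
- inversion h; last by [].
  by apply: (@ole_cocone _ _ n0); apply: IH.
Qed.

Lemma olt_OL_inv a f : olt a (OL f) -> exists n, olt a (f n).
Proof. by move=> h; inversion h; exists n. Qed.

Lemma ole_trans a b c : ole a b -> ole b c -> ole a c.
Proof.
move=> h; elim: h c => {a b}.
- by move=> b c _; exact: ole_zero.
- move=> a b _ IH c; elim: c => [|c IHc|g IHg] h.
  + by case: (ole_OSn0 h).
  + by apply: ole_succ; apply: IH; apply: ole_OS.
  + have [n hn] := olt_OL_inv h.
    by apply: (@ole_cocone _ _ n); apply: IHg.
- by move=> a f n _ IH c h; apply: IH; apply: ole_OL_inv h.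
- by move=> f b _ IH c h; apply: ole_limiting => n; apply: IH.
Qed.

Lemma ole_S a : ole a (OS a).
Proof.
elim: a => [|a IH|f IH]; [exact: ole_zero|exact: ole_succ|].
apply: ole_limiting => n; apply: ole_trans (IH n) _.
by apply: ole_succ; apply: ole_cocone.
Qed.

Lemma oltW a b : olt a b -> ole a b.
Proof. exact: ole_trans (ole_S a). Qed.

Lemma ole_lt_trans a b c : ole a b -> olt b c -> olt a c.
Proof. by move=> h; apply: ole_trans; apply: ole_succ. Qed.

Lemma olt_le_trans a b c : olt a b -> ole b c -> olt a c.
Proof. exact: ole_trans. Qed.

Lemma ole_or_lt a b : ole a b \/ olt b a.
Proof.
elim: a b => [|a IH|f IH] b.
- by left; apply: ole_zero.
- elim: b => [|b _|g IHg].
  + by right; apply: ole_succ; apply: ole_zero.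
  + by case: (IH b) => h; [left|right]; apply: ole_succ.
  + have [[n hn]|h] := pselect (exists n, ole (OS a) (g n)).
      by left; apply: ole_cocone hn.
    right; apply: ole_succ; apply: ole_limiting => n.
    case: (IHg n) => [hn|/ole_OS //].
    by case: h; exists n.
- have [[n hn]|h] := pselect (exists n, olt b (f n)).
    by right; apply: ole_cocone hn.
  left; apply: ole_limiting => n; case: (IH n b) => // hn.
  by case: h; exists n.
Qed.

Lemma oltxx a : ~ olt a a.
Proof.
elim: a => [|a IH|f IH] h; first exact: ole_OSn0 h.
  by apply: IH; apply: ole_OS.
have [n hn] := olt_OL_inv h; apply: (IH n).
by apply: ole_lt_trans hn; apply: ole_cocone.
Qed.

Lemma olt_nle a b : olt a b -> ~ ole b a.
Proof. by move=> h h'; apply: (@oltxx a); apply: olt_le_trans h h'. Qed.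

Lemma onle_lt a b : ~ ole a b -> olt b a.
Proof. by case: (ole_or_lt a b). Qed.

(** The operations recurse on their right argument, so this law and the associative and distributive
    laws below hold as equalities of terms, up to function extensionality, and can be used for
    rewriting. *)
Lemma oadd0l b : oadd OZ b = b.
Proof.
by elim: b => [|b /= ->|f IH] //=; congr OL; apply: funext.
Qed.

Lemma oaddA a b c : oadd (oadd a b) c = oadd a (oadd b c).
Proof.
by elim: c => [|c /= ->|f IH] //=; congr OL; apply: funext.
Qed.

Lemma ole_add2l a b c : ole b c -> ole (oadd a b) (oadd a c).
Proof.
elim=> {b c} /=.
- elim=> [|b IH|f IH] //=; first exact: ole_trans IH (ole_S _).
  exact: (ole_cocone (f := fun n => oadd a (f n)) (n := 0%N) (IH 0%N)).
- by move=> b c _ IH; apply: ole_succ.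
- by move=> b f n _ IH; apply: (ole_cocone (f := fun n => oadd a (f n))) IH.
- by move=> f b _ IH; apply: ole_limiting.
Qed.

Lemma olt_add2l a b c : olt b c -> olt (oadd a b) (oadd a c).
Proof. exact: (@ole_add2l a (OS b)). Qed.

Lemma ole_add2r a b c : ole a b -> ole (oadd a c) (oadd b c).
Proof.
move=> h; elim: c => [|c IH|f IH] //=; first exact: ole_succ.
by apply: ole_limiting => n; apply: (ole_cocone (f := fun n => oadd b (f n))) (IH n).
Qed.

Lemma ole_addr a b : ole a (oadd a b).
Proof. by apply: (@ole_add2l a OZ); apply: ole_zero. Qed.

Lemma ole_addl a b : ole b (oadd a b).
Proof. by rewrite -{1}[b]oadd0l; apply: ole_add2r; apply: ole_zero. Qed.

Lemma omulDr a b c : omul a (oadd b c) = oadd (omul a b) (omul a c).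
Proof.
elim: c => [|c /= ->|f IH] //=; first by rewrite oaddA.
by congr OL; apply: funext.
Qed.

Lemma omulA a b c : omul (omul a b) c = omul a (omul b c).
Proof.
elim: c => [|c /= ->|f IH] //=; first by rewrite omulDr.
by congr OL; apply: funext.
Qed.

Lemma omul1l b : omul oone b = b.
Proof.
by elim: b => [|b /= ->|f IH] //=; congr OL; apply: funext.
Qed.

Lemma ole_mul2l a b c : ole b c -> ole (omul a b) (omul a c).
Proof.
elim=> {b c} /=.
- by move=> b; apply: ole_zero.
- by move=> b c _ IH; apply: ole_add2r.
- by move=> b f n _ IH; apply: (ole_cocone (f := fun n => omul a (f n))) IH.
- by move=> f b _ IH; apply: ole_limiting.
Qed.

Lemma ole_mul2r a b c : ole a b -> ole (omul a c) (omul b c).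
Proof.
move=> h; elim: c => [|c IH|f IH] //=.
  exact: ole_trans (ole_add2r _ IH) (ole_add2l _ h).
by apply: ole_limiting => n; apply: (ole_cocone (f := fun n => omul b (f n))) (IH n).
Qed.

Lemma ole_mulr a b : ole oone a -> ole b (omul a b).
Proof. by move=> h; rewrite -{1}[b]omul1l; apply: ole_mul2r. Qed.

Lemma ole_mull a b : ole oone b -> ole a (omul a b).
Proof. by move=> /(ole_mul2l a) /=; rewrite oadd0l. Qed.

Lemma olt_mul_omega a b : olt a (omul b omega) -> exists n, olt a (omul b (onat n)).
Proof. exact: olt_OL_inv. Qed.

Lemma onatD m n : onat (m + n) = oadd (onat m) (onat n).
Proof. by elim: n => [|n IH]; rewrite ?addn0 // addnS /= IH. Qed.

Lemma opowD a b : opow (oadd a b) = omul (opow a) (opow b).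
Proof.
elim: b => [|b IH|f IH]; first by rewrite /= oadd0l.
  by rewrite -[opow (oadd a (OS b))]/(omul (opow (oadd a b)) omega) IH omulA.
by congr OL; apply: funext.
Qed.

Lemma ole1_opow a : ole oone (opow a).
Proof.
elim: a => [|a IH|f IH] //=.
  by apply: (ole_cocone (n := 1%N)); rewrite /= oadd0l.
exact: ole_cocone (IH 0%N).
Qed.

Lemma ole_opow a b : ole a b -> ole (opow a) (opow b).
Proof.
elim=> {a b} /=.
- exact: ole1_opow.
- by move=> a b _ IH; apply: (ole_mul2r omega).
- by move=> a f n _ IH; apply: (ole_cocone (f := fun n => opow (f n))) IH.
- by move=> f b _ IH; apply: ole_limiting.
Qed.

Lemma olt_opowS a : olt (opow a) (opow (OS a)).
Proof.
apply: (ole_cocone (n := 2%N)); rewrite /= oadd0l.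
exact: (ole_add2l _ (ole1_opow a)).
Qed.

Lemma ole_opowx a : ole a (opow a).
Proof.
elim: a => [|a IH|f IH]; first exact: ole_zero.
  apply: ole_trans (olt_opowS a); exact: ole_succ.
by apply: ole_limiting => n; apply: (ole_cocone (f := fun n => opow (f n))) (IH n).
Qed.

(** At a successor exponent both summands lie below finite multiples of a smaller power, and these
    add up to a finite multiple; at a supremum the larger of two indices serves both. *)
Lemma opow_add_closed c a b : olt a (opow c) -> olt b (opow c) ->
  olt (oadd a b) (opow c).
Proof.
elim: c a b => [|c IH|f IH] a b /=.
- move=> /ole_OS ha /ole_OS hb; apply: ole_succ.
  apply: ole_trans (ole_add2l _ hb) _; exact: ha.
- move=> /olt_mul_omega [m ha] /olt_mul_omega [n hb].
  apply: (ole_cocone (n := (m + n)%N)); rewrite onatD omulDr.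
  apply: ole_lt_trans (olt_add2l _ hb); apply: ole_add2r; exact: oltW.
- move=> /olt_OL_inv[m ha] /olt_OL_inv[n hb].
  have [h|/oltW h] := ole_or_lt (f m) (f n).
  + apply: (ole_cocone (n := n)); apply: IH => //.
    exact: olt_le_trans ha (ole_opow h).
  + apply: (ole_cocone (n := m)); apply: IH => //.
    exact: olt_le_trans hb (ole_opow h).
Qed.

Lemma olt1_opow a : ~ ole a OZ -> olt oone (opow a).
Proof.
move=> /onle_lt /ole_opow h; apply: olt_le_trans h.
exact: (olt_opowS OZ).
Qed.

Lemma opow_succ_closed c a : ~ ole c OZ -> olt a (opow c) -> olt (OS a) (opow c).
Proof.
move=> h0 ha; apply: (opow_add_closed (b := oone)) => //.
exact: olt1_opow.
Qed.

(** * Closure of the ordinals below omega^(omega^xi) under products *)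

Section DoubleExponential.
Variable xi : Ord.
Hypothesis xi0 : ~ ole xi OZ.

(** Since xi is nonzero, omega^xi is a limit, so omega^(omega^xi) is the supremum of the powers with
    smaller exponent. *)
Lemma olt_opow_opow a : olt a (opow (opow xi)) ->
  exists2 b, olt b (opow xi) & olt a (opow b).
Proof.
suff h B : ole B (opow xi) -> olt a (opow B) -> exists2 b, olt b (opow xi) & olt a (opow b).
  by apply: h.
elim: B => [|B _|f IH].
- move=> _ ha; exists OZ => //; exact: ole1_opow.
- by move=> hB ha; exists (OS B) => //; apply: opow_succ_closed.
- move=> hf /olt_OL_inv[n hn]; apply: IH hn; exact: ole_OL_inv hf.
Qed.

Lemma opow_opow_mul_closed a b : olt a (opow (opow xi)) ->
  olt b (opow (opow xi)) -> olt (omul a b) (opow (opow xi)).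
Proof.
move=> /olt_opow_opow[x hx ha] /olt_opow_opow[y hy hb].
apply: (ole_lt_trans (b := opow (oadd x y))).
  rewrite opowD; apply: ole_trans (ole_mul2r _ (oltW ha)) _.
  exact: ole_mul2l (oltW hb).
apply: olt_le_trans (olt_opowS _) (ole_opow _).
exact: opow_add_closed.
Qed.

Lemma opow_opow_succ_closed a : olt a (opow (opow xi)) -> olt (OS a) (opow (opow xi)).
Proof. by apply: opow_succ_closed; apply/olt_nle; exact: ole1_opow. Qed.

End DoubleExponential.

(** Descent along a bound Z with b < d * Z finds the last multiple of d that is not above b. [osubK]
    and [ell_exists] use the same descent. *)
Lemma odivision d b : ole oone d ->
  exists2 z, ole (omul d z) b & olt b (omul d (OS z)).
Proof.
move=> hd.
suff h Z : olt b (omul d Z) -> exists2 z, ole (omul d z) b & olt b (omul d (OS z)).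
  apply: (h (OS b)); apply: ole_lt_trans (ole_mulr b hd) _.
  exact: (ole_add2l _ hd).
elim: Z => [/ole_OSn0//|Z IH hb|f IH /olt_OL_inv[n /IH]//].
by have [h|/IH//] := ole_or_lt (omul d Z) b; exists Z.
Qed.

Lemma osubK a b : ole a b -> exists c, oeq b (oadd a c).
Proof.
move=> hab.
suff h Z : olt b (oadd a Z) -> exists c, oeq b (oadd a c).
  by apply: (h (OS b)); apply: ole_succ; apply: ole_addl.
elim: Z => [/olt_nle//|Z IH hb|f IH /olt_OL_inv[n /IH]//].
have [h|/IH//] := ole_or_lt (oadd a Z) b.
by exists Z; split => //; apply: ole_OS.
Qed.

Lemma ell_exists a : ole oone a -> exists g, ell_is a g.
Proof.
move=> ha; suff h Z : olt a (opow Z) -> exists g, ell_is a g.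
  by apply: (h (OS a)); apply: ole_lt_trans (ole_opowx a) (olt_opowS a).
elim: Z => [/olt_nle//|Z IH hb|f IH /olt_OL_inv[n /IH]//].
by have [h|/IH//] := ole_or_lt (opow Z) a; exists Z.
Qed.

(** * Transfinite derivatives *)

Section Derivatives.
Variables (U : Type) (D : set U -> set U).
Hypothesis D_sub : forall A, D A `<=` A.
Hypothesis D_mono : forall A B, A `<=` B -> D A `<=` D B.

Lemma oiter_sub A b : oiter D A b `<=` A.
Proof.
elim: b => [|b IH|f IH] x //=; first by move=> /D_sub /IH.
by move=> /(_ 0%N) /IH.
Qed.

Lemma oiter_anti A a b : ole a b -> oiter D A b `<=` oiter D A a.
Proof.
elim=> {a b} [b|a b _ IH|a f n _ IH|f b _ IH] /=.
- exact: oiter_sub.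
- exact: D_mono.
- by move=> x /(_ n) /IH.
- by move=> x hx n; apply: IH.
Qed.

Lemma oiter_limit A v b x : oiter D A v x ->
  (forall r, olt r b -> oiter D A (oadd v (OS r)) x) -> oiter D A (oadd v b) x.
Proof.
move=> hx; elim: b => [|b IH|f IH] //= h; first exact: h.
by move=> n; apply: IH => r hr; apply: h; apply: ole_cocone hr.
Qed.

(** A limit stage only intersects earlier ones, so a point that is lost by stage b is lost at a
    definite successor step; r is the rank of x. *)
Lemma oiter_rank A b x : A x -> ~ oiter D A b x ->
  exists r, [/\ olt r b, oiter D A r x & ~ oiter D A (OS r) x].
Proof.
move=> hx; elim: b => [//|b IH|f IH] /= hb.
- have [h|/IH[r [rb h1 h2]]] := pselect (oiter D A b x).
    by exists b; split => //; apply: olexx.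
  by exists r; split => //; apply: ole_trans rb (ole_S _).
- have /existsNP[n /IH[r [rb h1 h2]]] := hb.
  by exists r; split => //; apply: ole_cocone rb.
Qed.

End Derivatives.

(** * Averages that are small on low-rank families *)

Section Averages.
(** [L nu] stands for the nodes that survive nu derivations of a tree. [H] is the low-rank family on
    which averages shall be small, and [phi] is its rank function. *)
Variables (R : realType) (V : Type) (L : Ord -> set (seq V)).
Variables (H : set (seq V)) (phi : seq V -> Ord).
Hypothesis L_step : forall nu s, L (OS nu) s -> exists v, L nu (rcons s v).
Hypothesis L_lim : forall f n s, L (OL f) s -> L (f n) s.
Hypothesis H_prefix : forall h v, H (rcons h v) -> H h.
Hypothesis phi_decr : forall h v, H (rcons h v) -> olt (phi (rcons h v)) (phi h).

Definition weight (P : pred V) (w : seq (V * R)) : R := \sum_(x <- w | P x.1) x.2.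

Lemma weight_cat P w1 w2 : weight P (w1 ++ w2) = weight P w1 + weight P w2.
Proof. exact: big_cat. Qed.

Lemma weight_le P w : all (fun x => 0 <= x.2) w -> weight P w <= weight predT w.
Proof.
elim: w => [|x w IH]; rewrite /weight ?big_nil // !big_cons /= => /andP[x0 /IH w0].
by case: ifP => _; [rewrite lerD2l|apply: le_trans w0 _; rewrite lerDr].
Qed.

Lemma weight_scale P w (c : R) :
  weight P [seq (x.1, x.2 * c) | x <- w] = weight P w * c.
Proof. by rewrite /weight big_map mulr_suml. Qed.

Lemma H_cat h g : H (h ++ g) -> H h.
Proof.
elim/last_ind: g => [|g v IH]; first by rewrite cats0.
by rewrite -rcons_cat => /H_prefix.
Qed.

Lemma phi_cat h g : H (h ++ g) -> ole (phi (h ++ g)) (phi h).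
Proof.
elim/last_ind: g => [|g v IH]; first by rewrite cats0.
rewrite -rcons_cat => hH; apply: ole_trans (oltW (phi_decr hH)) (IH _).
exact: H_prefix hH.
Qed.

(** A finite list has only finitely many filtered sublists, so by monotonicity in the ordinal one
    index serves all of them. *)
Lemma directed_choice (Q : seq V -> Ord -> Prop) (f : nat -> Ord) s :
  (forall h a b, ole a b -> Q h a -> Q h b) ->
  (forall h, exists n, Q h (f n)) ->
  exists n, forall P, Q (filter P s) (f n).
Proof.
elim: s Q => [|v s IH] Q mono ex; first by have [n hn] := ex [::]; exists n.
have [n1 h1] := IH Q mono ex.
have [n2 h2] := IH (fun h => Q (v :: h)) (fun h => mono _) (fun h => ex _).
have [h|/oltW h] := ole_or_lt (f n1) (f n2).
- by exists n2 => P /=; case: ifP => _; [exact: h2|apply: mono h (h1 P)].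
- by exists n1 => P /=; case: ifP => _; [apply: mono h (h2 P)|exact: h1].
Qed.

(* Any multiple of [omega^eta] below the label at the start of a run is still
   below the label at its end: the run stays in one [omega^eta]-block. *)
Definition same_block (eta a b : Ord) : Prop :=
  forall z, ole (omul (opow eta) z) a -> ole (omul (opow eta) z) b.

(** The restriction to [same_block] is what makes induction on eta possible: in a long run of
    averages the rank leaves its omega^eta-block only boundedly often. *)
Definition averaging (eta : Ord) : Prop := forall nu s (eps : R), 0 < eps ->
  L (oadd nu (opow eta)) s ->
  exists w : seq (V * R), [/\ all (fun x => 0 <= x.2) w, weight predT w = 1,
    L nu (s ++ unzip1 w) &
    forall P : pred V, H (filter P (s ++ unzip1 w)) ->
      same_block eta (phi (filter P s)) (phi (filter P (s ++ unzip1 w))) ->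
      weight P w <= eps].

(** One new point takes all the weight. If P holds there, the rank drops strictly, which
    [same_block] forbids for blocks of length one. *)
Lemma averaging0 : averaging OZ.
Proof.
move=> nu s eps eps0 /= /L_step[v hv]; exists [:: (v, 1)].
rewrite /= cats1; split => //; first by rewrite ler01.
  by rewrite /weight big_cons big_nil addr0.
move=> P; rewrite /weight big_cons big_nil /= filter_rcons.
case: ifP => [_ hH /(_ (phi (filter P s)))|_ _ _]; last exact: ltW.
by rewrite !omul1l => /(_ (olexx _)) /olt_nle []; apply: phi_decr.
Qed.

(** The value a lies in the first omega^eta'-block of the omega^eta-block starting at omega^eta * Y.
    As b does not fall below that start, it does not leave the first small block downwards
    either. *)
Lemma same_block_sub eta eta' a b Y y : ole (omul (opow eta) Y) a ->
  olt a (omul (opow eta') (OS y)) -> ole (omul (opow eta') y) (omul (opow eta) Y) ->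
  same_block eta a b -> same_block eta' a b.
Proof.
move=> h1 h2 h3 hb z hz.
have zy : ole z y.
  have [//|yz] := ole_or_lt z y; case: (olt_nle h2).
  exact: ole_trans (ole_mul2l _ yz) hz.
by apply: ole_trans (ole_mul2l _ zy) _; apply: ole_trans h3 (hb _ h1).
Qed.

(** A rank in the omega^(sup f)-block with number z is below the start of the block plus omega^(f n)
    for some n. One n serves all sublists of s, and the case f n then applies. *)
Lemma averaging_lim f : (forall n, averaging (f n)) -> averaging (OL f).
Proof.
move=> IH nu s eps eps0 hs.
pose Q h a := exists2 z, ole (omul (opow (OL f)) z) (phi h) &
  olt (phi h) (oadd (omul (opow (OL f)) z) (opow a)).
have [||n hn] := @directed_choice Q f s.
- move=> h a b ab [z h1 h2]; exists z => //.
  exact: olt_le_trans h2 (ole_add2l _ (ole_opow ab)).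
- move=> h; have [z h1 h2] := odivision (phi h) (ole1_opow (OL f)).
  have [n hn] := olt_OL_inv h2; by exists n, z.
have [w [w0 w1 hL hw]] := IH n nu s eps eps0 (L_lim n hs).
exists w; split => // P hH hsb; apply: hw => //.
have [z h1 h2] := hn P.
have [c [hc1 hc2]] := osubK (ole_cocone (olexx (f n)) : ole (f n) (OL f)).
have E : oeq (omul (opow (OL f)) z) (omul (opow (f n)) (omul (opow c) z)).
  by rewrite -omulA -opowD; split; apply: ole_mul2r; apply: ole_opow.
apply: (same_block_sub h1 _ E.2 hsb).
by apply: olt_le_trans h2 _; apply: ole_add2r; exact: E.1.
Qed.

(** Concatenation of i averages. The rank stays above omega^eta * X and starts below omega^eta * (X
    + c), so at most c of the averages see it change its block. Each of these costs at most 1, every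
    other one at most eps. *)
Lemma averaging_iter eta (eps : R) : averaging eta -> 0 < eps -> forall i nu s,
  L (oadd nu (omul (opow eta) (onat i))) s ->
  exists w : seq (V * R), [/\ all (fun x => 0 <= x.2) w, weight predT w = i%:R,
    L nu (s ++ unzip1 w) &
    forall P : pred V, H (filter P (s ++ unzip1 w)) -> forall X c,
      ole (omul (opow eta) X) (phi (filter P (s ++ unzip1 w))) ->
      olt (phi (filter P s)) (omul (opow eta) (oadd X (onat c))) ->
      weight P w <= c%:R + i%:R * eps].
Proof.
move=> IH eps0; elim=> [|i IHi] nu s.
  move=> /= hs; exists [::]; rewrite /= cats0 /weight big_nil; split => //.
  by move=> P _ X c _ _; rewrite big_nil mul0r addr0.
rewrite -[omul _ _]/(oadd (omul (opow eta) (onat i)) (opow eta)) -oaddA => hs.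
have [w1 [w10 w11 hL1 hw1]] := IH _ _ _ eps0 hs.
have [w2 [w20 w21 hL2 hw2]] := IHi _ _ hL1.
exists (w1 ++ w2); rewrite /unzip1 map_cat catA; split => //.
- by rewrite all_cat w10 w20.
- by rewrite weight_cat w11 w21 -natr1 addrC.
move=> P hH X c hX hc; rewrite weight_cat.
have hE : filter P ((s ++ unzip1 w1) ++ unzip1 w2) =
          filter P (s ++ unzip1 w1) ++ filter P (unzip1 w2) by rewrite filter_cat.
have hE1 : filter P (s ++ unzip1 w1) =
          filter P s ++ filter P (unzip1 w1) by rewrite filter_cat.
have hH1 : H (filter P (s ++ unzip1 w1)) by move: hH; rewrite hE; apply: H_cat.
have le1 : ole (phi (filter P (s ++ unzip1 w1))) (phi (filter P s)).
  by move: hH1; rewrite hE1; apply: phi_cat.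
have le2 : ole (omul (opow eta) X) (phi (filter P (s ++ unzip1 w1))).
  by apply: ole_trans hX _; move: hH; rewrite hE; apply: phi_cat.
have [hsb|] := pselect (same_block eta (phi (filter P s)) (phi (filter P (s ++ unzip1 w1)))).
  have := hw1 P hH1 hsb; have := hw2 P hH X c hX (ole_lt_trans le1 hc).
  by rewrite -natr1 mulrDl mul1r; lra.
move=> /existsNP[Z /not_implyP[hZ1 /onle_lt hZ2]].
(* A block was left, and one unit of c pays for the weight 1 of [w1]. With c = 0 the rank would
   start below omega^eta * X and not be below it later. *)
case: c hc => [|c] hc.
  by case: (olt_nle hc); apply: ole_trans le2 le1.
have hZ : ole Z (oadd X (onat c)).
  have [//|hlt] := ole_or_lt Z (oadd X (onat c)).
  by case: (olt_nle hc); apply: ole_trans (ole_mul2l _ hlt) hZ1.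
have := hw2 P hH X c hX (olt_le_trans hZ2 (ole_mul2l _ hZ)).
have := weight_le P w10; rewrite w11 -!natr1 mulrDl mul1r; lra.
Qed.

(** The new average is the mean of M + 1 consecutive omega^eta-averages. The initial rank is below
    omega^eta * (omega * z + k) with k common to all sublists of s, so at most k of them are heavy,
    and M is chosen with k / (M + 1) < eps / 2. *)
Lemma averagingS eta : averaging eta -> averaging (OS eta).
Proof.
move=> IH nu s eps eps0 hs.
pose Q h a := exists z, ole (omul (opow eta) (omul omega z)) (phi h) /\
  olt (phi h) (omul (opow eta) (oadd (omul omega z) a)).
have [||k hk] := @directed_choice Q onat s.
- move=> h a b ab [z [h1 h2]]; exists z; split => //.
  exact: olt_le_trans h2 (ole_mul2l _ (ole_add2l _ ab)).
- move=> h; have [z] := odivision (phi h) (ole1_opow (OS eta)).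
  rewrite -[opow (OS eta)]/(omul (opow eta) omega) omulA => h1.
  rewrite -[omul _ (OS z)]/(oadd (omul (omul (opow eta) omega) z) (omul (opow eta) omega)).
  rewrite omulA -omulDr => h2.
  by have [n hn] := olt_OL_inv h2; exists n, z.
have [M hM] : exists M, (k%:R / M.+1%:R : R) < eps / 2.
  exists (Num.bound (k.+1%:R / (eps / 2))).
  have q0 : 0 <= k.+1%:R / (eps / 2) by apply: divr_ge0 => //; apply/ltW/divr_gt0.
  have := archi_boundP q0.
  rewrite ltr_pdivrMr; last by apply: divr_gt0.
  move=> hb; rewrite ltr_pdivrMr ?ltr0n // mulrC.
  apply: le_lt_trans (lt_le_trans hb _); first by rewrite ler_nat.
  by apply: ler_wpM2r; [apply: ltW; apply: divr_gt0|rewrite ler_nat].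
have eps20 : 0 < eps / 2 by apply: divr_gt0.
have [w [w0 w1 hL hw]] := averaging_iter IH eps20 (L_lim M.+1 hs : L (oadd nu (omul (opow eta) (onat M.+1))) s).
exists [seq (x.1, x.2 * M.+1%:R^-1) | x <- w].
have E : unzip1 [seq (x.1, x.2 * M.+1%:R^-1) | x <- w] = unzip1 w.
  by rewrite /unzip1 -map_comp; apply: eq_map.
rewrite E; split => //.
- rewrite all_map; apply: sub_all w0 => x x0 /=.
  by apply: mulr_ge0.
- by rewrite weight_scale w1 mulfV // pnatr_eq0.
move=> P hH hsb; rewrite weight_scale.
have [z [h1 h2]] := hk P.
have h3 := hsb z; rewrite -[opow (OS eta)]/(omul (opow eta) omega) omulA in h3.
have := hw P hH _ _ (h3 h1) h2.
rewrite ler_pdivrMr ?ltr0n // => hle; apply: le_trans hle _.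
move: hM; rewrite ltr_pdivrMr ?ltr0n // => hM; lra.
Qed.

Lemma averaging_all eta : averaging eta.
Proof.
elim: eta => [|eta IH|f IH]; [exact: averaging0|exact: averagingS|exact: averaging_lim].
Qed.

(** If the run starts at the empty list with rank below omega^eta, the only multiple of omega^eta
    under this rank is 0, and [same_block] is automatic. *)
Lemma small_average eta nu (eps : R) : 0 < eps -> L (oadd nu (opow eta)) [::] ->
  olt (phi [::]) (opow eta) ->
  exists w : seq (V * R), [/\ all (fun x => 0 <= x.2) w, weight predT w = 1,
    L nu (unzip1 w) &
    forall P : pred V, H (filter P (unzip1 w)) -> weight P w <= eps].
Proof.
move=> eps0 hL hphi; have [w [w0 w1 hL1 hw]] := averaging_all eps0 hL.
exists w; split => // P hH; apply: hw => // z hz.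
have z0 : ole z OZ.
  have [//|z1] := ole_or_lt z OZ; case: (olt_nle hphi).
  by apply: ole_trans hz; apply: ole_mull.
exact: ole_trans (ole_mul2l _ z0) (ole_zero _).
Qed.

End Averages.

(** * Cantor-Bendixson ranks of families *)

Lemma finite_bound (A : set nat) : finite_set A -> exists m, forall k, A k -> (k < m)%N.
Proof.
move=> /finite_seqP[s ->]; exists (\max_(i <- s) i).+1 => k /= ks.
by rewrite ltnS; apply: leq_bigmax_seq.
Qed.

Lemma set_rcons (s : seq nat) k : [set` rcons s k] = k |` [set` s].
Proof.
apply/seteqP; split => x /=; rewrite mem_rcons inE.
  by move=> /orP[/eqP|]; [left|right].
by case=> [->|->]; rewrite ?eqxx // orbT.
Qed.

Lemma set_nil : [set` ([::] : seq nat)] = set0.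
Proof. by apply/seteqP; split => x. Qed.

Definition near_regular (F : nfamily) :=
  [/\ finite_sets F, hereditary F & spreading F].

Lemma regular_near F : regular F -> near_regular F.
Proof. by case=> *; split. Qed.

(** A member that agrees with the finite set A past its maximum and differs from A must properly
    contain it; heredity trims it to A with one far element added. *)
Lemma cb_derivP F A : near_regular F -> cb_deriv F A <->
  F A /\ forall n, exists k, [/\ (n <= k)%N, ~ A k & F (k |` A)].
Proof.
move=> [fF hF sF]; split => -[FA h]; split => // n.
- have [m hm] := finite_bound (fF _ FA).
  have [B [FB BA agr]] := h (maxn n m).
  have AB : A `<=` B.
    by move=> k Ak; apply/agr => //; apply: leq_trans (hm _ Ak) (leq_maxr _ _).
  have [k [Bk Ak]] : exists k, B k /\ ~ A k.
    apply: contrapT => hno; apply: BA; apply/seteqP; split => // k Bk.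
    by apply: contrapT => Ak; apply: hno; exists k.
  exists k; split => //.
    apply: contrapT => /negP; rewrite -ltnNge => kn; apply: Ak.
    by apply/(agr k) => //; apply: leq_trans kn (leq_maxl _ _).
  by apply: hF FB _ => x [->|/AB].
- have [k [nk Ak Fk]] := h n; exists (k |` A); split => //.
    by move=> E; apply: Ak; rewrite -E; left.
  move=> j jn; split; first by right.
  by case=> // jk; rewrite jk ltnNge nk in jn.
Qed.

Lemma cb_deriv_sub F : cb_deriv F `<=` F.
Proof. by move=> A []. Qed.

Lemma cb_deriv_mono F G : F `<=` G -> cb_deriv F `<=` cb_deriv G.
Proof.
move=> FG A [/FG ? h]; split => // n.
by have [B [/FG ? ? ?]] := h n; exists B.
Qed.

Lemma near_regular_cb F : near_regular F -> near_regular (cb_deriv F).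
Proof.
move=> nF; have [fF hF sF] := nF; split.
- by move=> A /cb_deriv_sub /fF.
- move=> A B /(cb_derivP _ nF)[FA h] BA; apply/(cb_derivP _ nF); split.
    exact: hF FA BA.
  move=> n; have [k [nk Ak Fk]] := h n; exists k; split => //; first by move/BA.
  by apply: hF Fk _ => x [->|/BA]; [left|right].
- move=> A g /(cb_derivP _ nF)[FA h] gi ge; apply/(cb_derivP _ nF); split.
    exact: sF.
  move=> n; have [m hm] := finite_bound (fF _ (sF _ _ FA gi ge)).
  have [m' hm'] := finite_bound (fF _ FA).
  have [k [nk Ak Fk]] := h (maxn n (maxn m m')).
  have km : (m <= k)%N by apply: leq_trans nk; rewrite !leq_max leqnn orbT.
  have km' : (m' <= k)%N by apply: leq_trans nk; rewrite !leq_max leqnn !orbT.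
  exists k; split.
  + by apply: leq_trans nk; rewrite leq_maxl.
  + by move=> /hm; rewrite ltnNge km.
  (* The new element k lies beyond A and beyond its image, so extending g by the identity at k gives
     a spread again. *)
  pose g' x := if x == k then k else g x.
  have g'A a : A a -> g' a = g a.
    by rewrite /g'; case: eqP => // -> .
  suff <- : g' @` (k |` A) = k |` (g @` A).
    apply: sF => // [a a'|a].
      move=> [->|Aa] [->|Aa']; rewrite ?ltnn //.
      + by move=> /ltnW /(leq_trans km'); rewrite leqNgt (hm' _ Aa').
      + by move=> _; rewrite (g'A _ Aa) /g' eqxx; apply: leq_trans km; apply: hm; exists a.
      + by rewrite !g'A //; apply: gi.
    by move=> [->|Aa]; [rewrite /g' eqxx|rewrite g'A // ge].
  apply/seteqP; split => x /=.
    move=> [a [->|Aa] <-]; first by left; rewrite /g' eqxx.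
    by right; exists a => //; rewrite g'A.
  move=> [->|[a Aa <-]]; first by exists k; [left|rewrite /g' eqxx].
  by exists a; [right|rewrite g'A].
Qed.

Lemma near_regular_oiter F b : near_regular F -> near_regular (oiter cb_deriv F b).
Proof.
move=> nF; elim: b => [|b IH|f IH] //=; first exact: near_regular_cb.
split.
- by move=> A FA; have [h _ _] := IH 0%N; apply: h (FA 0%N).
- by move=> A B FA BA n; have [_ h _] := IH n; apply: h (FA n) BA.
- by move=> A g FA gi ge n; have [_ _ h] := IH n; apply: h (FA n) gi ge.
Qed.

Lemma sorted_rcons_lt (s : seq nat) k x : sorted ltn (rcons s k) -> x \in s -> (x < k)%N.
Proof.
rewrite -cats1 => srt xs.
have : sorted ltn [:: x; k].
  apply: (subseq_sorted ltn_trans _ srt); apply: (@cat_subseq _ [:: x] [:: k]) => //.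
  by rewrite sub1seq.
by rewrite /= andbT.
Qed.

Lemma sorted_rcons (s : seq nat) k : sorted ltn s -> (forall x, x \in s -> (x < k)%N) ->
  sorted ltn (rcons s k).
Proof.
by case: s => [|a s] //= hs h; rewrite rcons_path hs /= h // mem_last.
Qed.

(** Spreading moves the last element k arbitrarily far out, so s is a limit of other members of the
    derived family. *)
Lemma oiter_cb_shrink F b s k : near_regular F -> sorted ltn (rcons s k) ->
  oiter cb_deriv F b [set` rcons s k] -> oiter cb_deriv F (OS b) [set` s].
Proof.
move=> nF srt hb; have nFb := near_regular_oiter b nF.
have [_ hF sF] := nFb.
apply/(cb_derivP _ nFb); split.
  by apply: hF hb _ => x /= xs; rewrite mem_rcons inE xs orbT.
move=> n; exists (maxn n k); split; first exact: leq_maxl.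
  by move=> /= /(sorted_rcons_lt srt); rewrite ltnNge leq_maxr.
pose g x := if x == k then maxn n k else x.
have gs x : x \in s -> g x = x.
  by rewrite /g; case: eqP => // -> /(sorted_rcons_lt srt); rewrite ltnn.
suff <- : g @` [set` rcons s k] = maxn n k |` [set` s].
  apply: sF => // [a a'|a] /=; rewrite !mem_rcons !inE.
    move=> /orP[/eqP->|sa] /orP[/eqP->|sa']; rewrite ?ltnn //.
    - by move=> ka'; have := sorted_rcons_lt srt sa'; rewrite ltnNge (ltnW ka').
    - by move=> _; rewrite (gs _ sa) {1}/g eqxx (leq_trans (sorted_rcons_lt srt sa)) ?leq_maxr.
    - by rewrite !gs.
  by move=> /orP[/eqP->|sa]; [rewrite /g eqxx leq_maxr|rewrite gs].
apply/seteqP; split => x /=.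
  move=> [a]; rewrite mem_rcons inE => /orP[/eqP->|sa] <-.
    by left; rewrite /g eqxx.
  by right; rewrite gs.
move=> [->|xs]; first by exists k; rewrite ?mem_rcons ?inE ?eqxx // /g eqxx.
by exists x; rewrite ?gs // mem_rcons inE xs orbT.
Qed.

Lemma oiter_cb_grow F b s n : near_regular F -> sorted ltn s ->
  oiter cb_deriv F (OS b) [set` s] ->
  exists k, [/\ (n <= k)%N, sorted ltn (rcons s k) & oiter cb_deriv F b [set` rcons s k]].
Proof.
move=> nF srt /= /(cb_derivP _ (near_regular_oiter b nF))[_ h].
have [k [nk _ Fk]] := h (maxn n (\max_(i <- s) i).+1).
exists k; split.
- by apply: leq_trans nk; apply: leq_maxl.
- apply: sorted_rcons => // x xs; apply: leq_trans nk; rewrite leq_max ltnS.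
  by rewrite (leq_bigmax_seq _ xs) // orbT.
- by rewrite set_rcons.
Qed.

(** A decreasing rank function stands in for iterated derivatives, so that unions and compositions
    of families can be bounded by explicit formulas. *)
Definition ranked (H : set (seq nat)) (b : Ord) : Prop :=
  exists2 phi : seq nat -> Ord, ole (phi [::]) b &
    forall s k, sorted ltn (rcons s k) -> H (rcons s k) ->
      olt (phi (rcons s k)) (phi s).

Definition subseq_closed (H : set (seq nat)) : Prop :=
  forall s s', subseq s' s -> H s -> H s'.

Lemma hereditary_subseq F : hereditary F -> subseq_closed [set s | F [set` s]].
Proof. by move=> hF s s' ss' /= Fs; apply: hF Fs _ => x /=; apply: (mem_subseq ss'). Qed.

(** The rank of s is the last stage at which s survives. It is at most b: a family with the empty
    set as its only member has no second member near it, so its derivative is empty. *)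
Lemma iota_ranked F b : regular F -> iota_is F b -> ranked [set s | F [set` s]] b.
Proof.
move=> /regular_near nF hb.
have [phi hphi] : {phi : seq nat -> Ord & forall s, F [set` s] ->
    [/\ olt (phi s) (OS b), oiter cb_deriv F (phi s) [set` s] &
      ~ oiter cb_deriv F (OS (phi s)) [set` s]]}.
  apply: (choice (P := fun s r => F [set` s] -> [/\ olt r (OS b), oiter cb_deriv F r [set` s] &
      ~ oiter cb_deriv F (OS r) [set` s]])) => s.
  have [Fs|nFs] := pselect (F [set` s]); last by exists OZ.
  have [|r hr] := @oiter_rank _ cb_deriv F (OS b) [set` s] Fs; last by exists r.
  move=> /= [h1 h2]; rewrite hb in h1 h2.
  by have [B [/= BE nE _]] := h2 0%N; rewrite h1 BE in nE.
have sub_closed s k : F [set` rcons s k] -> F [set` s].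
  have [_ hF _] := nF; apply: hereditary_subseq => //; exact: subseq_rcons.
exists phi.
  have [|h1 _ _] := hphi [::]; last exact: ole_OS.
  rewrite set_nil.
  have : oiter cb_deriv F b set0 by rewrite hb.
  by apply: oiter_sub; exact: cb_deriv_sub.
move=> s k srt /= Fk; have [_ h1 _] := hphi _ Fk; have [_ _ h2] := hphi _ (sub_closed _ _ Fk).
have [h|//] := ole_or_lt (phi s) (phi (rcons s k)); case: h2.
apply: (oiter_anti cb_deriv_sub cb_deriv_mono (ole_succ h)).
exact: oiter_cb_shrink h1.
Qed.

Lemma ranked_le H b b' : ole b b' -> ranked H b -> ranked H b'.
Proof. by move=> h [phi h1 h2]; exists phi => //; apply: ole_trans h1 h. Qed.

Lemma ranked_sub H H' b : H `<=` H' -> ranked H' b -> ranked H b.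
Proof. by move=> h [phi h1 h2]; exists phi => // s k ss /h; apply: h2. Qed.

Lemma ranked0 b : ranked set0 b.
Proof. by exists (fun=> b). Qed.

Definition omax a b := if `[< ole a b >] then b else a.

Lemma ole_maxl a b : ole a (omax a b).
Proof. by rewrite /omax; case: asboolP. Qed.

Lemma ole_maxr a b : ole b (omax a b).
Proof. by rewrite /omax; case: asboolP => // /onle_lt /oltW. Qed.

Lemma omax_ind (Q : Ord -> Prop) a b : Q a -> Q b -> Q (omax a b).
Proof. by rewrite /omax; case: asboolP. Qed.

(** The rank is the maximum of the two ranks where both are meaningful; closure under sublists keeps
    s in every family that contains its extension. *)
Lemma rankedU H1 H2 b : subseq_closed H1 -> subseq_closed H2 ->
  ranked H1 b -> ranked H2 b -> ranked (H1 `|` H2) b.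
Proof.
move=> c1 c2 [p1 p1b p1d] [p2 p2b p2d].
pose phi s := if `[< H1 s >] then if `[< H2 s >] then omax (p1 s) (p2 s) else p1 s
              else p2 s.
have phi1 s : H1 s -> ole (p1 s) (phi s).
  by move=> h; rewrite /phi asboolT //; case: ifP => // _; apply: ole_maxl.
have phi2 s : H2 s -> ole (p2 s) (phi s).
  move=> h; rewrite /phi (asboolT h); case: ifP => // _; exact: ole_maxr.
exists phi.
  rewrite /phi; case: ifP => // _; case: ifP => // _.
  exact: (@omax_ind (fun x => ole x b)).
move=> s k ss hU.
have h1 : H1 (rcons s k) -> olt (p1 (rcons s k)) (phi s).
  move=> h; apply: olt_le_trans (p1d _ _ ss h) (phi1 _ _).
  by apply: c1 h; apply: subseq_rcons.
have h2 : H2 (rcons s k) -> olt (p2 (rcons s k)) (phi s).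
  move=> h; apply: olt_le_trans (p2d _ _ ss h) (phi2 _ _).
  by apply: c2 h; apply: subseq_rcons.
rewrite {1}/phi; case: asboolP => h1'; last by case: hU => // /h2.
case: asboolP => h2'; last exact: h1.
by apply: (@omax_ind (fun x => olt x (phi s))); [exact: h1|exact: h2].
Qed.

(** A maximum of finitely many ordinals is one of them, so Q can be any property: below it is a
    strict bound, or being a product [aprod alpha l]. *)
Lemma ranked_bigcup (Q : Ord -> Prop) (H0 : set (seq nat)) (H : nat -> set (seq nat)) N b0 :
  subseq_closed H0 -> (forall n, subseq_closed (H n)) ->
  Q b0 -> ranked H0 b0 ->
  (forall n, (n < N)%N -> exists2 b, Q b & ranked (H n) b) ->
  exists2 b, Q b & ranked [set s | H0 s \/ exists2 n, (n < N)%N & H n s] b.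
Proof.
move=> c0 cH Qb0 r0; elim: N => [|N IH] hN.
  by exists b0 => //; apply: ranked_sub r0 => s [//|[]].
have [n nN|b Qb rb] := IH; first by apply: hN; apply: ltnW.
have [b' Qb' rb'] := hN N (ltnSn N).
exists (omax b b'); first exact: omax_ind.
apply: ranked_sub (rankedU _ (cH N) (ranked_le (ole_maxl b b') rb) (ranked_le (ole_maxr b b') rb')).
  move=> s [h|[n]]; first by left; left.
  rewrite ltnS leq_eqVlt => /orP[/eqP->|nN] h; first by right.
  by left; right; exists n.
move=> s s' ss [h|[n nN h]]; first by left; apply: c0 h.
by right; exists n => //; apply: cH h.
Qed.

Lemma subseq_behead (T : eqType) (s s' : seq T) : subseq s' s -> subseq (behead s') (behead s).
Proof.
case: s => [|x s]; first by rewrite subseq0 => /eqP->.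
case: s' => [|y s'] /=; first by rewrite sub0seq.
case: eqP => // _; exact: subseq_trans (subseq_cons _ _).
Qed.

(** The free first element will absorb a block vector that straddles a breakpoint. *)
Definition cons_family (G : set (seq nat)) : set (seq nat) := [set s | G (behead s)].

Lemma subseq_closed_cons G : subseq_closed G -> subseq_closed (cons_family G).
Proof. by move=> hG s s' /subseq_behead; apply: hG. Qed.

Lemma ranked_cons G b : ranked G b -> ranked (cons_family G) (OS b).
Proof.
move=> [phi h0 h]; exists (fun s => if s is x :: s' then phi s' else OS (phi [::])).
  exact: ole_succ.
move=> [|x s] k /=; first by move=> *; apply: olexx.
by move=> /path_sorted; apply: h.
Qed.

(** Sending the i-th element of [es] to the i-th element of [P] is a spread of an initial part of
    [es]. *)
Lemma spread_dominated F es P : near_regular F -> sorted ltn es -> sorted ltn P ->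
  F [set` es] -> (size P <= size es)%N ->
  (forall i, (i < size P)%N -> (nth 0%N es i <= nth 0%N P i)%N) -> F [set` P].
Proof.
move=> [fF hF sF] ses sP Fes szP le.
have Ft : F [set` take (size P) es].
  by apply: hF Fes _ => x /= /mem_take.
pose g a := nth 0%N P (index a es).
have ues := sorted_uniq ltn_trans ltnn ses.
have mt a : a \in take (size P) es -> exists i, [/\ (i < size P)%N, a = nth 0%N es i & g a = nth 0%N P i].
  move=> /(nthP 0%N)[i]; rewrite size_takel // => iP; rewrite nth_take // => <-.
  by exists i; split => //; rewrite /g index_uniq // (leq_trans iP).
suff -> : [set` P] = g @` [set` take (size P) es].
  apply: sF => // [a a'|a] /=.
    move=> /mt[i [iP -> ->]] /mt[j [jP -> ->]] hij.
    rewrite (sorted_ltn_nth ltn_trans) //.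
    rewrite ltnNge; apply/negP => ji; move: hij; rewrite ltnNge => /negP; apply.
    by rewrite (sorted_leq_nth leq_trans leqnn) ?inE ?(leq_trans iP) ?(leq_trans jP) //;
      apply: sub_sorted ses => x y /ltnW.
  by move=> /mt[i [iP -> ->]]; apply: le.
apply/seteqP; split => x /=.
  move=> /(nthP 0%N)[i iP <-]; exists (nth 0%N es i).
    by rewrite -(nth_take _ iP); apply: mem_nth; rewrite size_takel.
  by rewrite /g index_uniq // (leq_trans iP).
by move=> [a /mt[i [iP _ ->]] <-]; apply: mem_nth.
Qed.

(** * The family [F[G]] *)

(* The breakpoints [es] cut the integers into intervals; [cut_index es k] is the
   (one-based) number of the interval containing [k], and [0] below [es]. *)
Definition cut_index (es : seq nat) (k : nat) : nat := count (fun e => (e <= k)%N) es.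

Definition comb (F : nfamily) (G : set (seq nat)) : set (seq nat) :=
  [set h | exists es : seq nat, [/\ sorted ltn es, F [set` es],
     forall k, k \in h -> (0 < cut_index es k)%N &
     forall i, G (filter (fun k => cut_index es k == i) h)]].

Lemma subseq_filter_sub (T : eqType) (P : pred T) s s' : subseq s' s ->
  subseq (filter P s') (filter P s).
Proof.
move=> /subseqP[m _ ->]; elim: s m => [|x s IH] [|[] m] //=.
- by rewrite sub0seq.
- by case: ifP => _ //=; rewrite eqxx.
- by case: ifP => _ //; apply: subseq_trans (subseq_cons _ _).
Qed.

Lemma subseq_closed_comb F G : subseq_closed G -> subseq_closed (comb F G).
Proof.
move=> hG s s' ss [es [h1 h2 h3 h4]]; exists es; split => //.
  by move=> k /(mem_subseq ss); apply: h3.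
by move=> i; apply: hG (h4 i); apply: subseq_filter_sub.
Qed.

Lemma leq_cut_index es k k' : (k <= k')%N -> (cut_index es k <= cut_index es k')%N.
Proof. by move=> kk; apply: sub_count => e /= /leq_trans; apply. Qed.

Lemma nth_lt_cut es i k : sorted ltn es -> (i < cut_index es k)%N -> (nth 0%N es i <= k)%N.
Proof.
rewrite /cut_index; elim: es i => [//|e es IH] i /= hp.
have ses := path_sorted hp.
case: (leqP e k) => ek; first by case: i => //= i; rewrite add1n ltnS; apply: IH.
suff -> : count (fun e => (e <= k)%N) es = 0%N by [].
apply/eqP; rewrite -leqn0 leqNgt -has_count; apply/hasPn => x xs.
by rewrite -ltnNge; apply: ltn_trans ek _; have /allP := order_path_min ltn_trans hp; apply.
Qed.

Section Greedy.
Variable G : set (seq nat).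
Hypothesis G_closed : subseq_closed G.

(* Cutting greedily gives the latest possible breakpoints. *)
Definition greedy_step (st : seq nat * seq nat) (k : nat) :=
  if (st.1 != [::]) && `[< G (rcons st.2 k) >] then (st.1, rcons st.2 k)
  else (rcons st.1 k, [:: k]).

Definition greedy (h : seq nat) := foldl greedy_step ([::], [::]) h.

Lemma greedy_rcons h k : greedy (rcons h k) = greedy_step (greedy h) k.
Proof. by rewrite /greedy -cats1 foldl_cat. Qed.

(** The breakpoints [es] are any witness of membership in F[G]. Greedy cutting opens at most as many
    pieces, and each of its breakpoints comes no earlier than that of [es] with the same index. When
    the numbers of pieces agree, the open greedy piece lies inside that of [es], so a rejection by G
    shows that [es] has opened a further one. *)
Lemma greedy_inv es h x : sorted ltn es -> sorted ltn (rcons h x) ->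
  (forall k, k \in rcons h x -> (0 < cut_index es k)%N) ->
  (forall i, G (filter (fun k => cut_index es k == i) (rcons h x))) ->
  let: (P, B) := greedy (rcons h x) in
  [/\ P != [::], sorted ltn P /\ sorted ltn B, (forall y, y \in P ++ B -> (y <= x)%N),
      (size P <= cut_index es x)%N /\
      (forall i, (i < size P)%N -> (nth 0%N es i <= nth 0%N P i)%N) &
      G B /\
      (size P = cut_index es x -> subseq B (filter (fun k => cut_index es k == cut_index es x) (rcons h x)))].
Proof.
move=> ses; elim/last_ind: h x => [|h y IH] x srt pos hG.
  rewrite /greedy /= /greedy_step /=; split => //.
  - by move=> y; rewrite /= !inE => /orP[] /eqP->.
  - have hx : (0 < cut_index es x)%N by apply: pos; rewrite inE.
    by split => // -[|//] _ /=; apply: nth_lt_cut.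
  - split; first by have := hG (cut_index es x); rewrite /= eqxx.
    by move=> _; rewrite /= !eqxx.
have yx : (y < x)%N by apply: (sorted_rcons_lt srt); rewrite mem_rcons inE eqxx.
have srt' : sorted ltn (rcons h y).
  by apply: (subseq_sorted ltn_trans _ srt); apply: subseq_rcons.
rewrite greedy_rcons; have {IH} := IH y srt'.
case: (greedy (rcons h y)) => P B IH.
have {IH}[||P0 [sP sB] Pm [szP leP] [GB subB]] := IH.
- by move=> k hk; apply: pos; rewrite mem_rcons inE hk orbT.
- by move=> i; apply: G_closed (hG i); apply: subseq_filter_sub; apply: subseq_rcons.
have PmP z : z \in P -> (z < x)%N.
  by move=> zP; apply: leq_ltn_trans yx; apply: Pm; rewrite mem_cat zP.
have PmB z : z \in B -> (z < x)%N.
  by move=> zB; apply: leq_ltn_trans yx; apply: Pm; rewrite mem_cat zB orbT.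
have cyx := leq_cut_index es (ltnW yx).
have key : size P = cut_index es x ->
    subseq (rcons B x) (filter (fun k => cut_index es k == cut_index es x) (rcons (rcons h y) x)).
  move=> E; have E' : cut_index es y = cut_index es x by apply/eqP; rewrite eqn_leq cyx -E szP.
  rewrite filter_rcons eqxx -[rcons B x]cats1 -[rcons (filter _ _) x]cats1.
  by rewrite cat_subseq // -E' subB // E E'.
rewrite /greedy_step /= P0 /=; case: asboolP => hB.
  split => //; first by split => //; apply: sorted_rcons.
  - move=> z; rewrite mem_cat mem_rcons inE => /orP[/PmP/ltnW//|/orP[/eqP->//|/PmB/ltnW//]].
  - by split => //; apply: leq_trans szP cyx.
have lt : (size P < cut_index es x)%N.
  rewrite ltn_neqAle (leq_trans szP cyx) andbT; apply/eqP => /key hk.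
  by apply: hB; apply: G_closed hk (hG _).
split => //.
- by case: (P).
- by split => //; apply: sorted_rcons.
- move=> z; rewrite mem_cat mem_rcons !inE => /orP[/orP[/eqP->//|/PmP/ltnW//]|/eqP->//].
- rewrite size_rcons; split => // i; rewrite ltnS leq_eqVlt nth_rcons.
  move=> /orP[/eqP->|iP]; last by rewrite iP leP.
  by rewrite ltnn eqxx; apply: nth_lt_cut.
- have sx : subseq [:: x] (filter (fun k => cut_index es k == cut_index es x) (rcons (rcons h y) x)).
    by rewrite sub1seq mem_filter eqxx mem_rcons inE eqxx.
  by split => //; apply: G_closed sx (hG _).
Qed.

(** A list is ranked by c times the rank of its greedy breakpoints plus the rank of the open piece.
    A longer piece lowers the second term. A new breakpoint lowers the first by at least c, which
    exceeds the rank of a piece with one element. *)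
Lemma ranked_comb F bF bG : near_regular F ->
  ranked [set s | F [set` s]] bF -> ranked G bG -> ranked (comb F G) (omul bG bF).
Proof.
move=> nF [pF hF0 hF] [pG hG0 hG].
pose c := pG [::].
(* On the empty list no piece is open and the second term is absent; this keeps the bound at the
   bare product. *)
pose phi h := if h is [::] then omul c (pF [::])
  else oadd (omul c (pF (greedy h).1)) (pG (greedy h).2).
have phi_rcons h k : phi (rcons h k) =
    oadd (omul c (pF (greedy (rcons h k)).1)) (pG (greedy (rcons h k)).2).
  by case: h.
exists phi.
  exact: ole_trans (ole_mul2r _ hG0) (ole_mul2l _ hF0).
move=> h k srt [es [ses Fes pos cls]].
have inv := greedy_inv ses srt pos cls.
have inF P : sorted ltn P -> (size P <= cut_index es k)%N ->
    (forall i, (i < size P)%N -> (nth 0%N es i <= nth 0%N P i)%N) -> F [set` P].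
  move=> sP szP leP; apply: spread_dominated leP => //.
  exact: leq_trans szP (count_size _ _).
have G1 : G [:: k].
  apply: G_closed (cls (cut_index es k)); rewrite sub1seq mem_filter eqxx.
  by rewrite mem_rcons inE eqxx.
have new P : sorted ltn (rcons P k) -> F [set` rcons P k] ->
    olt (oadd (omul c (pF (rcons P k))) (pG [:: k])) (omul c (pF P)).
  move=> sP FP; apply: olt_le_trans (ole_mul2l c (hF _ _ sP FP)).
  by apply: olt_add2l; apply: (hG [::]).
rewrite phi_rcons; rewrite greedy_rcons in inv *.
case/lastP: h srt pos cls inv => [|h y] srt pos cls inv.
  rewrite /greedy /= /greedy_step /= in inv *.
  case: inv => _ [sP _] _ [szP leP] _.
  by apply: (new [::]) => //; apply: inF.
have srt' : sorted ltn (rcons h y).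
  by apply: (subseq_sorted ltn_trans _ srt); apply: subseq_rcons.
have := greedy_inv ses srt'; rewrite phi_rcons.
move: inv; case: (greedy (rcons h y)) => P B inv inv'.
have {inv'}[||P0 [sP sB] Pm [szP leP] [GB subB]] := inv'.
- by move=> z hz; apply: pos; rewrite mem_rcons inE hz orbT.
- by move=> i; apply: G_closed (cls i); apply: subseq_filter_sub; apply: subseq_rcons.
move: inv; rewrite /greedy_step /= P0 /=; case: asboolP => hB /= inv.
  by apply: olt_add2l; apply: hG => //; case: inv => _ [].
case: inv => _ [sP' _] _ [szP' leP'] _.
by apply: olt_le_trans (ole_addr _ _); apply: new => //; apply: inF.
Qed.
End Greedy.

(** * The norming set *)

Section NormingSet.
Variables (R : realType) (F : nat -> nfamily) (theta : nat -> R).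

Definition step_fun (n : nat) (Es : seq (set nat)) (fs : nat -> nat -> R) (k : nat) : R :=
  theta n * \sum_(i < size Es) (k \in nth set0 Es i)%:R * fs i k.

(** All coordinates are nonnegative and pairings are taken with |x|, as the norm depends on |x|
    only. *)
Inductive norming : (nat -> R) -> Prop :=
| norming_base A : F 0%N A -> norming (fun k => (k \in A)%:R)
| norming_step n Es fs : (1 <= n)%N -> admissible (F n) Es ->
    (forall i, (i < size Es)%N -> norming (fs i)) -> norming (step_fun n Es fs).

Definition supp_lt (B : nat) (x : nat -> R) : Prop := forall k, (B <= k)%N -> x k = 0.

Definition pairing (B : nat) (f x : nat -> R) : R := \sum_(k < B) f k * `|x k|.

Lemma finsupp_lt x : finsupp x -> exists B, supp_lt B x.
Proof.
move=> /finite_bound[m hm]; exists m => k mk; apply/eqP; rewrite -[_ == _]negbK.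
by apply/negP => /hm; rewrite ltnNge mk.
Qed.

Lemma lt_finsupp B x : supp_lt B x -> finsupp x.
Proof.
move=> h; apply: sub_finite_set (finite_II B) => k /=.
by apply: contraR; rewrite -leqNgt => /h ->.
Qed.

Lemma supp_lt_restrict B E x : supp_lt B x -> supp_lt B (Defs.restrict E x).
Proof. by move=> h k /h; rewrite /Defs.restrict => ->; rewrite if_same. Qed.

(** The sets of an admissible list are disjoint, so at k at most one term survives, at an index
    independent of [fs]. *)
Lemma adm_cases G Es k : admissible G Es ->
  (exists i, [/\ (i < size Es)%N, k \in nth set0 Es i &
     forall fs : nat -> nat -> R,
       \sum_(i < size Es) (k \in nth set0 Es i)%:R * fs i k = fs i k]) \/
  (forall i, (i < size Es)%N -> k \notin nth set0 Es i) /\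
  forall fs : nat -> nat -> R,
    \sum_(i < size Es) (k \in nth set0 Es i)%:R * fs i k = 0.
Proof.
move=> [_ _ disj _].
have [[i [isz ki]]|h] := pselect (exists i, (i < size Es)%N /\ k \in nth set0 Es i).
- left; exists i; split => // fs; rewrite (bigD1 (Ordinal isz)) //= ki mul1r.
  rewrite big1 ?addr0 // => j ji; rewrite (_ : k \in _ = false) ?mul0r //.
  apply/negP => kj; have [ij|ij|ij] := ltngtP i j.
  + by have := disj i j k k ij (ltn_ord j); rewrite ltnn !inE in ki kj * => /(_ ki kj).
  + by have := disj j i k k ij isz; rewrite ltnn !inE in ki kj * => /(_ kj ki).
  + by move/eqP: ji; apply; apply/val_inj.
- have hn i : (i < size Es)%N -> k \notin nth set0 Es i.
    by move=> isz; apply/negP => ki; apply: h; exists i.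
  right; split => // fs; apply: big1 => i _.
  by rewrite (negbTE (hn _ (ltn_ord i))) mul0r.
Qed.

Hypothesis F_reg : forall n, regular (F n).
Hypothesis F_S0 : forall n, S0 `<=` F n.
Hypothesis theta01 : forall n, (1 <= n)%N -> 0 < theta n < 1.

Lemma theta_gt0 n : (1 <= n)%N -> 0 < theta n.
Proof. by move=> /theta01 /andP[]. Qed.

Lemma theta_le1 n : (1 <= n)%N -> theta n <= 1.
Proof. by move=> /theta01 /andP[_ /ltW]. Qed.

Lemma norming_01 f : norming f -> forall k, 0 <= f k <= 1.
Proof.
elim=> {f} [A _ k|n Es fs n1 adm _ IH k]; first by case: (k \in A); rewrite ?ler01 ?lexx.
have t0 := theta_gt0 n1; have t1 := theta_le1 n1.
rewrite /step_fun; case: (adm_cases k adm) => [[i [isz _ ->]]|[_ ->]].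
  have /andP[h0 h1] := IH i isz k.
  by rewrite mulr_ge0 ?(ltW t0) //= mulr_ile1 // ltW.
by rewrite mulr0 lexx ler01.
Qed.

Lemma norming_ge0 f k : norming f -> 0 <= f k.
Proof. by move=> /norming_01 /(_ k) /andP[]. Qed.

Lemma norming_le1 f k : norming f -> f k <= 1.
Proof. by move=> /norming_01 /(_ k) /andP[]. Qed.

Lemma pairing_ge0 B f x : norming f -> 0 <= pairing B f x.
Proof. by move=> hf; apply: sumr_ge0 => k _; apply: mulr_ge0 => //; apply: norming_ge0. Qed.

Lemma pairing_step B n Es fs x : pairing B (step_fun n Es fs) x =
  theta n * \sum_(i < size Es) pairing B (fs i) (Defs.restrict (nth set0 Es i) x).
Proof.
rewrite /pairing exchange_big mulr_sumr; apply: eq_bigr => k _.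
rewrite /step_fun -mulrA mulr_suml; congr (_ * _); apply: eq_bigr => i _.
by rewrite /Defs.restrict; case: ifP => _; rewrite ?mul1r // normr0 mulr0 !mul0r.
Qed.

Lemma fsum_pairing B A x : finite_set A -> supp_lt B x ->
  \sum_(k \in A) `|x k| = pairing B (fun k => (k \in A)%:R) x.
Proof.
move=> fA hx; rewrite /pairing (fsbig_ord _ _ (fun k => (k \in A)%:R * `|x k|)).
transitivity (\sum_(k \in A `&` `I_B) `|x k|).
  apply/esym/fsbig_widen; first by move=> k [].
  move=> k [Ak hk] /=; rewrite hx ?normr0 // leqNgt; apply/negP => kB.
  by apply: hk; split.
transitivity (\sum_(k \in A `&` `I_B) (k \in A)%:R * `|x k|).
  by apply: eq_fsbigr => k; rewrite inE => -[Ak _]; rewrite mem_set // mul1r.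
apply: fsbig_widen; first by move=> k [].
move=> k [kB hk] /=; rewrite memNset ?mul0r // => Ak; exact: hk.
Qed.

Definition l1 (B : nat) (x : nat -> R) : R := \sum_(k < B) `|x k|.

Lemma pairing_l1 B f x : norming f -> pairing B f x <= l1 B x.
Proof.
move=> hf; apply: ler_sum => k _; rewrite -[leRHS]mul1r ler_wpM2r //.
exact: norming_le1.
Qed.

Lemma l1_ge0 B x : 0 <= l1 B x.
Proof. exact: sumr_ge0. Qed.

Lemma sum_l1_adm G Es B x : admissible G Es ->
  \sum_(i < size Es) l1 B (Defs.restrict (nth set0 Es i) x) <= l1 B x.
Proof.
move=> adm; rewrite exchange_big; apply: ler_sum => k _ /=.
have E : \sum_(i < size Es) `|Defs.restrict (nth set0 Es i) x k| =
         \sum_(i < size Es) (val k \in nth set0 Es i)%:R * `|x k|.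
  apply: eq_bigr => i _; rewrite /Defs.restrict; case: ifP => _; rewrite ?mul1r //.
  by rewrite normr0 mul0r.
rewrite E; case: (adm_cases k adm) => [[i [_ _ h]]|[_ h]].
  by rewrite (h (fun _ k => `|x k|)).
by rewrite (h (fun _ k => `|x k|)).
Qed.

Definition norm_terms j x := [set r | exists n Es, [/\ (1 <= n)%N, admissible (F n) Es &
  r = theta n * \sum_(E <- Es) mtn F theta j (Defs.restrict E x)]].

Lemma mtnS j x : mtn F theta j.+1 x =
  Num.max (normF (F 0%N) x) (sup (norm_terms j x)).
Proof. by []. Qed.

Lemma F_fin n A : F n A -> finite_set A.
Proof. by have [h _ _ _] := F_reg n; apply: h. Qed.

Lemma F_nil n : F n set0.
Proof. by apply: F_S0; left. Qed.

Lemma normF_ub B x : supp_lt B x ->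
  ubound [set r | exists2 A, F 0%N A & r = (\sum_(k \in A) `|x k|)%R] (l1 B x).
Proof.
move=> hx r [A FA ->]; rewrite (fsum_pairing (F_fin FA) hx).
by apply: pairing_l1; apply: norming_base.
Qed.

Lemma norm_terms_ub B j x : supp_lt B x ->
  (forall y, supp_lt B y -> mtn F theta j y <= l1 B y) ->
  ubound (norm_terms j x) (l1 B x).
Proof.
move=> hx IH r [n [Es [n1 adm ->]]].
rewrite (big_nth set0) big_mkord.
have h : \sum_(i < size Es) mtn F theta j (Defs.restrict (nth set0 Es i) x) <= l1 B x.
  apply: le_trans (sum_l1_adm B x adm); apply: ler_sum => i _; apply: IH.
  exact: supp_lt_restrict.
apply: le_trans (ler_wpM2l (ltW (theta_gt0 n1)) h) _.
by rewrite -[leRHS]mul1r ler_wpM2r ?l1_ge0 // theta_le1.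
Qed.

Lemma mtn_l1 B j x : supp_lt B x -> mtn F theta j x <= l1 B x.
Proof.
have h0 y : supp_lt B y -> normF (F 0%N) y <= l1 B y.
  move=> hy; apply: ge_sup (normF_ub hy); eexists; exists set0; first exact: F_nil.
  by [].
elim: j x => [|j IH] x hx; first exact: h0.
rewrite mtnS ge_max h0 //=.
have [->|/set0P ne] := eqVneq (norm_terms j x) set0; first by rewrite sup0 l1_ge0.
exact: ge_sup (norm_terms_ub hx IH).
Qed.

(** The stage j0 bounds the nesting depth of f: it is one more than the largest stage of its
    finitely many parts. *)
Lemma norming_le_mtn f : norming f -> exists j0, forall j B x, (j0 <= j)%N ->
  supp_lt B x -> pairing B f x <= mtn F theta j x.
Proof.
have base A B x : F 0%N A -> supp_lt B x ->
    pairing B (fun k => (k \in A)%:R) x <= normF (F 0%N) x.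
  move=> FA hx; rewrite -(fsum_pairing (F_fin FA) hx); apply: ub_le_sup.
    by exists (l1 B x); apply: normF_ub.
  by exists A.
elim=> {f} [A FA|n Es fs n1 adm _ IH].
  exists 0%N => -[|j] B x _ hx; first exact: base.
  by rewrite mtnS le_max base.
have [js hjs] : {js : nat -> nat & forall i, (i < size Es)%N -> forall j B x, (js i <= j)%N ->
    supp_lt B x -> pairing B (fs i) x <= mtn F theta j x}.
  apply: (choice (P := fun i j0 => (i < size Es)%N -> forall j B x, (j0 <= j)%N ->
    supp_lt B x -> pairing B (fs i) x <= mtn F theta j x)) => i.
  have [/IH[j0 hj]|ni] := pselect (i < size Es)%N; last by exists 0%N.
  by exists j0.
exists (\max_(i < size Es) js i).+1 => -[//|j] B x jj hx.
rewrite mtnS le_max; apply/orP; right; rewrite pairing_step.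
apply: (@le_trans _ _ (theta n * \sum_(E <- Es) mtn F theta j (Defs.restrict E x))).
  apply: ler_wpM2l; first exact/ltW/theta_gt0.
  rewrite (big_nth set0) big_mkord; apply: ler_sum => i _.
  apply: hjs => //; last exact: supp_lt_restrict.
  by rewrite ltnS in jj; apply: leq_trans jj; apply: (leq_bigmax i).
apply: ub_le_sup; last by exists n, Es.
exists (l1 B x); apply: norm_terms_ub => // y; exact: mtn_l1.
Qed.

Lemma mtn_le_mt_norm j x : finsupp x -> mtn F theta j x <= mt_norm F theta x.
Proof.
move=> /finsupp_lt[B hx]; apply: ub_le_sup; last by exists j.
by exists (l1 B x) => _ [i _ <-]; apply: mtn_l1.
Qed.

Lemma norming_le B f x : norming f -> supp_lt B x -> pairing B f x <= mt_norm F theta x.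
Proof.
move=> /norming_le_mtn[j hj] hx; apply: le_trans (hj j B x (leqnn j) hx) _.
exact: mtn_le_mt_norm (lt_finsupp hx).
Qed.

(** Half of the tolerance is spent on nearly attaining the supremum; the other half is shared
    equally by the sets of the admissible list, where functionals come from induction on j. *)
Lemma mtn_approx B j x (e : R) : 0 < e -> supp_lt B x ->
  exists2 f, norming f & mtn F theta j x <= pairing B f x + e.
Proof.
have base y d : 0 < d -> supp_lt B y ->
    exists2 f, norming f & normF (F 0%N) y <= pairing B f y + d.
  move=> d0 hy; have [|_ [A FA ->] h] := @sup_adherent _ [set r | exists2 A, F 0%N A & r = (\sum_(k \in A) `|y k|)%R] d d0.
    split; last by exists (l1 B y); apply: normF_ub.
    by eexists; exists set0; first exact: F_nil.
  exists (fun k => (k \in A)%:R); first exact: norming_base.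
  by rewrite -fsum_pairing //; [move: h; rewrite ltrBlDr /normF => /ltW|apply: F_fin FA].
elim: j x e => [|j IH] x e e0 hx; first exact: base.
rewrite mtnS; have [f hf hle] := base x e e0 hx.
case: (leP (sup (norm_terms j x)) (normF (F 0%N) x)) => _; first by exists f.
have [->|/set0P ne] := eqVneq (norm_terms j x) set0.
  by exists f => //; rewrite sup0 addr_ge0 ?pairing_ge0 // ltW.
have e20 : 0 < e / 2 by apply: divr_gt0.
have [|_ [n [Es [n1 adm ->]]] h] := sup_adherent e20 (E := norm_terms j x).
  split => //; exists (l1 B x); apply: norm_terms_ub => // y; exact: mtn_l1.
have sz0 : (0 < size Es)%N by case: adm.
pose d := e / 2 / (size Es)%:R.
have d0 : 0 < d by rewrite divr_gt0 ?ltr0n.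
have [fs hfs] : {fs : nat -> nat -> R & forall i, norming (fs i) /\
    mtn F theta j (Defs.restrict (nth set0 Es i) x) <=
    pairing B (fs i) (Defs.restrict (nth set0 Es i) x) + d}.
  apply: (choice (P := fun i f => norming f /\
    mtn F theta j (Defs.restrict (nth set0 Es i) x) <=
    pairing B f (Defs.restrict (nth set0 Es i) x) + d)) => i.
  have [g hg hle'] := IH (Defs.restrict (nth set0 Es i) x) d d0 (supp_lt_restrict _ hx).
  by exists g.
exists (step_fun n Es fs).
  by apply: norming_step => // i _; case: (hfs i).
rewrite pairing_step; move: h; rewrite (big_nth set0) big_mkord.
set S1 := \sum_(i < _) _; set S2 := \sum_(i < _) _ => h.
have le12 : S1 <= S2 + e / 2.
  have -> : e / 2 = \sum_(i < size Es) d.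
    by rewrite sumr_const card_ord -[RHS]mulr_natr /d divfK // pnatr_eq0 -lt0n.
  rewrite /S2 -big_split; apply: ler_sum => i _; by case: (hfs i).
have := ler_wpM2l (ltW (theta_gt0 n1)) le12; rewrite mulrDr.
have := ler_wpM2r (ltW e20) (theta_le1 n1); rewrite mul1r; lra.
Qed.

Lemma mt_norm_le B x c : supp_lt B x -> (forall f, norming f -> pairing B f x <= c) ->
  mt_norm F theta x <= c.
Proof.
move=> hx h; apply: ge_sup; first by eexists; exists 0%N.
move=> _ [j _ <-]; apply/ler_addgt0Pr => e e0.
have [f hf hle] := mtn_approx j e0 hx; apply: le_trans hle _.
by rewrite lerD2r h.
Qed.

Lemma pairingZ B f x (c : R) : 0 <= c ->
  pairing B f (fun k => c * x k) = c * pairing B f x.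
Proof.
move=> c0; rewrite /pairing mulr_sumr; apply: eq_bigr => k _.
by rewrite normrM ger0_norm // mulrCA.
Qed.

Lemma mt_normZ_le B x c : 0 <= c -> supp_lt B x ->
  mt_norm F theta (fun k => c * x k) <= c * mt_norm F theta x.
Proof.
move=> c0 hx; apply: (mt_norm_le (B := B)) => [k /hx ->|f hf]; first by rewrite mulr0.
by rewrite pairingZ // ler_wpM2l // norming_le.
Qed.

Lemma mt_normZ B x c : 0 < c -> supp_lt B x ->
  mt_norm F theta (fun k => c * x k) = c * mt_norm F theta x.
Proof.
move=> c0 hx; apply/eqP; rewrite eq_le (mt_normZ_le (ltW c0) hx) /=.
have hcx : supp_lt B (fun k => c * x k) by move=> k /hx ->; rewrite mulr0.
have := @mt_normZ_le B (fun k => c * x k) c^-1; rewrite invr_ge0 ltW // => /(_ isT hcx).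
rewrite [X in mt_norm _ _ X](_ : _ = x); last first.
  by apply: funext => k; rewrite mulKf // gt_eqF.
by rewrite -(ler_pM2l c0) mulrA divff ?gt_eqF // mul1r.
Qed.

End NormingSet.

(** * Block sequences *)

Lemma lt_cut_nth es i k : sorted ltn es -> (i < size es)%N -> (nth 0%N es i <= k)%N ->
  (i < cut_index es k)%N.
Proof.
rewrite /cut_index; elim: es i => [//|e es IH] [|i] /= hp; first by move=> _ ->.
rewrite ltnS => isz ik; have := IH i (path_sorted hp) isz ik.
have ek : (e <= k)%N.
  apply: leq_trans ik; apply: ltnW.
  by have /allP := order_path_min ltn_trans hp; apply; apply: mem_nth.
by rewrite ek add1n ltnS.
Qed.

Lemma subseq_filter_imp (T : eqType) (P Q : pred T) s :
  (forall x, x \in s -> P x -> Q x) -> subseq (filter P s) (filter Q s).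
Proof.
move=> h; suff -> : filter P s = filter P (filter Q s) by apply: filter_subseq.
rewrite -filter_predI; apply: eq_in_filter => x xs /=.
by case Px: (P x) => //=; rewrite h.
Qed.

Lemma admissible_mins F Es : hereditary F -> admissible F Es -> exists es : seq nat,
  [/\ size es = size Es, sorted ltn es, F [set` es] &
      forall i, (i < size Es)%N -> is_min_of (nth set0 Es i) (nth 0%N es i)].
Proof.
move=> hF [sz0 fin disj Fm].
have [e he] : {e : nat -> nat & forall i, (i < size Es)%N -> is_min_of (nth set0 Es i) (e i)}.
  apply: (choice (P := fun i m => (i < size Es)%N -> is_min_of (nth set0 Es i) m)) => i.
  have [isz|] := ltnP i (size Es); last by exists 0%N.
  have [_ /eqP/set0P[k Ek]] := fin i isz.
  have ex : exists k, k \in nth set0 Es i by exists k; rewrite inE.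
  exists (ex_minn ex) => _; case: ex_minnP => m; rewrite inE => Em hm; split => // k' Ek'.
  by apply: hm; rewrite inE.
exists (mkseq e (size Es)); split => //; first by rewrite size_mkseq.
- rewrite sorted_pairwise; last exact: ltn_trans.
  apply/(pairwiseP 0%N) => i j; rewrite !inE size_mkseq => isz jsz ij.
  by rewrite !nth_mkseq //; apply: (disj i j) => //; [apply: (he i _).1|apply: (he j _).1].
- apply: hF Fm _ => x /= /mapP[i]; rewrite mem_iota add0n => /= isz ->.
  by exists i => //; apply: he.
- by move=> i isz; rewrite nth_mkseq //; apply: he.
Qed.

Section Blocks.
Variables (V : eqType) (S : V -> set nat) (pos : V -> nat).

Definition good (v : V) : Prop := S v (pos v) /\ forall k, S v k -> (k <= pos v)%N.

Definition before (v v' : V) : bool := `[< forall k, S v' k -> (pos v < k)%N >].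

Definition blocks (w : seq V) : Prop := {in w, forall v, good v} /\ pairwise before w.

Lemma blocks_subseq w w' : subseq w' w -> blocks w -> blocks w'.
Proof.
move=> ss [h1 h2]; split; first by move=> v /(mem_subseq ss); apply: h1.
exact: subseq_pairwise ss h2.
Qed.

Lemma blocks_sorted w : blocks w -> sorted ltn (map pos w).
Proof.
move=> [h1 h2]; rewrite sorted_pairwise; last exact: ltn_trans.
rewrite pairwise_map; apply: (sub_in_pairwise _ _ h2 (P := mem w)) => [v v' vw v'w|].
  by move=> /asboolP; apply; case: (h1 v' v'w).
by apply/allP.
Qed.

(** The witnesses in A increase strictly from block to block, and moving each of them up to [pos v]
    is a spread. *)
Lemma hit_family F A (I : pred V) w : near_regular F -> F A -> blocks w ->
  (forall v, v \in w -> I v ->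
     exists a k, [/\ A a, S v k, (k <= a)%N & (a <= pos v)%N]) ->
  F [set` map pos (filter I w)].
Proof.
move=> nF FA bw h; have [_ hF _] := nF.
set l := filter I w.
have bl : blocks l by apply: blocks_subseq bw; apply: filter_subseq.
have [a ha] : {a : V -> nat & forall v, v \in l ->
    [/\ A (a v), exists2 k, S v k & (k <= a v)%N & (a v <= pos v)%N]}.
  apply: (choice (P := fun v a => v \in l ->
    [/\ A a, exists2 k, S v k & (k <= a)%N & (a <= pos v)%N])) => v.
  have [|nv] := boolP (v \in l); last by exists 0%N.
  rewrite mem_filter => /andP[Iv vw]; have [a [k [? ? ? ?]]] := h v vw Iv.
  by exists a => _; split => //; exists k.
apply: (spread_dominated (es := map a l)) => //.
- rewrite sorted_pairwise; last exact: ltn_trans.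
  rewrite pairwise_map; apply: (sub_in_pairwise _ _ bl.2 (P := mem l)) => [v v' vw v'w|].
    move=> /asboolP hb; have [_ _ h1] := ha v vw; have [_ [k Sk h2] _] := ha v' v'w.
    exact: leq_ltn_trans h1 (leq_trans (hb _ Sk) h2).
  by apply/allP.
- exact: blocks_sorted.
- by apply: hF FA _ => _ /= /mapP[v vl ->]; case: (ha v vl).
- by rewrite !size_map.
move=> i; rewrite size_map => isz.
have [v0 _] : exists v0 : V, True by case: (l) isz => // v0 ? _; exists v0.
rewrite !(nth_map v0) //; by case: (ha (nth v0 l i)); rewrite ?mem_nth.
Qed.

Definition meets_only (Es : seq (set nat)) (j : nat) (v : V) : bool :=
  `[< forall k i, S v k -> (i < size Es)%N -> nth set0 Es i k -> i = j >].

(** The cuts are made at the minima of the sets. Among the selected blocks ending between two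
    consecutive minima only the first can begin before the left one. The later ones meet no set but
    the one starting there, and [cons_family] disregards the first. *)
Lemma comb_family F Es (I : pred V) (G : set (seq nat)) w : near_regular F ->
  admissible F Es -> blocks w -> subseq_closed G ->
  (forall v, v \in w -> I v ->
     exists j k, [/\ (j < size Es)%N, nth set0 Es j k & S v k]) ->
  (forall j, (j < size Es)%N ->
     G (map pos (filter (fun v => I v && meets_only Es j v) w))) ->
  comb F (cons_family G) (map pos (filter I w)).
Proof.
move=> nF adm bw cG hI hG; have [_ hF _] := nF.
have [es [szes ses Fes he]] := admissible_mins hF adm.
have [sz0 _ disj _] := adm.
exists es; split => //.
- move=> x /mapP[v]; rewrite mem_filter => /andP[Iv vw] ->.
  have [j [k [jsz Ek Sk]]] := hI v vw Iv.
  apply: leq_ltn_trans (leq0n j) (lt_cut_nth ses _ _); rewrite ?szes //.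
  apply: leq_trans ((he j jsz).2 _ Ek) _.
  by apply: (bw.1 v vw).2.
move=> i; rewrite filter_map -filter_predI; set l := filter _ _.
rewrite /cons_family /=.
have G0 : G [::] by apply: cG (hG 0%N sz0); apply: sub0seq.
case El : l => [//|v1 l'] /=.
have inl v : v \in l -> [/\ v \in w, I v & cut_index es (pos v) = i].
  by rewrite mem_filter /= -andbA => /and3P[/eqP].
have lw : subseq (v1 :: l') w by rewrite -El; apply: filter_subseq.
have [v1w Iv1 ci1] : [/\ v1 \in w, I v1 & cut_index es (pos v1) = i].
  by apply: inl; rewrite El mem_head.
have [j0 [k0 [j0sz Ek0 Sk0]]] := hI v1 v1w Iv1.
have ij0 : (j0 < i)%N.
  rewrite -ci1; apply: lt_cut_nth; rewrite ?szes //.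
  by apply: leq_trans ((he j0 j0sz).2 _ Ek0) _; apply: (bw.1 v1 v1w).2.
(* [cut_index] counts from one, so piece i belongs to the set with index i - 1. *)
have isz : (i.-1 < size Es)%N.
  rewrite prednK; last exact: leq_ltn_trans ij0.
  by rewrite -ci1 -szes; apply: count_size.
apply: cG (hG i.-1 isz); apply: map_subseq.
suff hall : {in l', forall v, I v && meets_only Es i.-1 v}.
  have /all_filterP <- : all (fun v => I v && meets_only Es i.-1 v) l' by apply/allP.
  by apply: subseq_filter_sub; apply: subseq_trans lw; apply: subseq_cons.
move=> v vl'; have [vw Iv ci] : [/\ v \in w, I v & cut_index es (pos v) = i].
  by apply: inl; rewrite El inE vl' orbT.
rewrite Iv /=; apply/asboolP => k m Sk msz Ek.
have v1v : before v1 v.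
  have := subseq_pairwise lw bw.2; rewrite /= => /andP[/allP h _]; exact: h.
have mi : (m < i)%N.
  rewrite -ci; apply: lt_cut_nth; rewrite ?szes //.
  by apply: leq_trans ((he m msz).2 _ Ek) _; apply: (bw.1 v vw).2.
apply/eqP; rewrite eqn_leq -ltnS prednK ?mi; last exact: leq_ltn_trans mi.
rewrite leqNgt; apply/negP => lt.
have h1 : (k < nth 0%N es i.-1)%N by apply: (disj m i.-1) => //; apply: (he i.-1 isz).1.
have h2 : (nth 0%N es i.-1 <= pos v1)%N.
  apply: nth_lt_cut => //.
  by rewrite ci1 prednK // (leq_ltn_trans _ mi).
have /asboolP/(_ k Sk) h3 := v1v.
by have := leq_trans h3 (leq_trans (ltnW h1) h2); rewrite ltnn.
Qed.

End Blocks.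

(** * The upper bound *)

Section Trees.
Variables (R : realType) (T : set (seq (nat -> R))).

Lemma tree_deriv_sub (A : set (seq (nat -> R))) : tree_deriv A `<=` A.
Proof. by move=> t []. Qed.

Lemma tree_deriv_mono (A B : set (seq (nat -> R))) : A `<=` B -> tree_deriv A `<=` tree_deriv B.
Proof. by move=> h t [/h ? [u [/h ? ? ?]]]; split => //; exists u. Qed.

Hypothesis T_take : forall t n, T t -> (0 < n)%N -> (n <= size t)%N -> T (take n t).

Lemma oiter_tree_take nu t n : oiter (@tree_deriv R) T nu t -> (0 < n)%N -> (n <= size t)%N ->
  oiter (@tree_deriv R) T nu (take n t).
Proof.
move=> ht n0; elim: nu ht => [|nu IH|f IH] /= ht nt; first exact: T_take.
  have [h [u hu]] := ht; have [nlt|ge] := ltnP n (size t).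
    split; first exact: IH.
    by exists t; rewrite size_take nlt; split.
  by rewrite take_oversize.
by move=> i; apply: IH.
Qed.

Lemma oiter_tree_step nu t : oiter (@tree_deriv R) T (OS nu) t ->
  exists v, oiter (@tree_deriv R) T nu (rcons t v).
Proof.
move=> /= [_ [u [hu szu tu]]]; exists (nth (fun=> 0) u (size t)).
have := oiter_tree_take hu (ltn0Sn (size t)) szu.
by rewrite (take_nth (fun=> 0)) // tu.
Qed.

End Trees.

(** * Norming functionals on convex combinations of block vectors *)

Section Vectors.
Variables (R : realType) (F : nat -> nfamily) (theta : nat -> R).
Hypothesis F_reg : forall n, regular (F n).
Hypothesis F_S0 : forall n, S0 `<=` F n.
Hypothesis theta01 : forall n, (1 <= n)%N -> 0 < theta n < 1.
Local Notation vec := (nat -> R).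
Local Notation N := (mt_norm F theta).

Definition supp (x : vec) : set nat := [set k | x k != 0].

Definition maxsupp (x : vec) : nat :=
  xget 0%N [set m | x m != 0 /\ forall k, x k != 0 -> (k <= m)%N].

(** A vector of norm 1 is not zero, so its support has a maximum and the default value in [maxsupp]
    does not occur. *)
Lemma good_vec (x : vec) : finsupp x -> N x = 1 -> good supp maxsupp x.
Proof.
move=> /finsupp_lt[B hB] Nx.
have [k xk] : exists k, x k != 0.
  apply: contrapT => h; have x0 : supp_lt 0 x.
    move=> k _; apply/eqP; rewrite -[_ == _]negbK; apply/negP => xk; by apply: h; exists k.
  suff : N x <= 0 by rewrite Nx ler10.
  by apply: (mt_norm_le F_reg F_S0 theta01 x0) => f _; rewrite /pairing big_ord0.
have ub i : x i != 0 -> (i <= B)%N.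
  by move=> xi0; rewrite leqNgt; apply/negP => /ltnW /hB E; rewrite E eqxx in xi0.
have ex : exists k, x k != 0 by exists k.
have hm : [set m | x m != 0 /\ forall k, x k != 0 -> (k <= m)%N] (ex_maxn ex ub).
  by case: ex_maxnP => m xm hm; split.
by rewrite /good /maxsupp /supp /=; have [] := @xgetPex _ 0%N _ (ex_intro _ _ hm).
Qed.

Definition pair1 (f : vec) (x : vec) : R := pairing (maxsupp x).+1 f x.

Lemma good_supp_lt x : good supp maxsupp x -> supp_lt (maxsupp x).+1 x.
Proof.
move=> [_ h] k hk; apply/eqP; rewrite -[_ == _]negbK; apply/negP => /h.
by rewrite leqNgt hk.
Qed.

Lemma pairing_widen (B B' : nat) (f x : vec) : (B <= B')%N -> supp_lt B x ->
  pairing B' f x = pairing B f x.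
Proof.
move=> BB' hx; rewrite /pairing -!(big_mkord xpredT (fun k => f k * `|x k|)).
rewrite (big_cat_nat (n := B)) //= [X in _ + X]big_nat_cond [X in _ + X]big1 ?addr0 //.
by move=> k /andP[/andP[Bk _] _]; rewrite hx // normr0 mulr0.
Qed.

Definition pairs (f : vec) (y : seq (vec * R)) : R := \sum_(p <- y) p.2 * pair1 f p.1.

Definition unit_good (x : vec) : Prop := good supp maxsupp x /\ N x = 1.

Lemma pair1_le1 f x : norming F theta f -> unit_good x -> pair1 f x <= 1.
Proof.
move=> hf [gx <-]; apply: (norming_le F_reg F_S0 theta01) => //.
exact: good_supp_lt.
Qed.

Lemma pairs_le1 f y : norming F theta f -> {in unzip1 y, forall x, unit_good x} ->
  all (fun p => 0 <= p.2) y -> weight predT y = 1 -> pairs f y <= 1.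
Proof.
move=> hf hy /allP y0 <-; rewrite /pairs /weight [leLHS]big_seq [leRHS]big_seq.
apply: ler_sum => p py; rewrite -[leRHS]mulr1 ler_wpM2l ?y0 //.
by apply: pair1_le1 => //; apply: hy; apply: map_f.
Qed.

Lemma pair1_only n Es fs j x : (1 <= n)%N -> admissible (F n) Es -> (j < size Es)%N ->
  norming F theta (fs j) ->
  (forall k i, x k != 0 -> (i < size Es)%N -> nth set0 Es i k -> i = j) ->
  pair1 (step_fun theta n Es fs) x <= theta n * pair1 (fs j) x.
Proof.
move=> n1 adm jsz fj only; rewrite /pair1 /pairing mulr_sumr; apply: ler_sum => k _.
have t0 := ltW (theta_gt0 theta01 n1).
have [->|xk] := eqVneq (x k) 0; first by rewrite normr0 !mulr0.
rewrite /step_fun; case: (adm_cases R k adm) => [[i [isz ki ->]]|[_ ->]].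
  by rewrite (only _ _ xk isz) ?mulrA //; move: ki; rewrite inE.
rewrite mulr0 mul0r; do 2 apply: mulr_ge0 => //.
exact: (norming_ge0 theta01 _ fj).
Qed.

Definition split_by (Es : seq (set nat)) (x : vec) : bool :=
  `[< exists i j k k', [/\ (i < j)%N, (j < size Es)%N,
     nth set0 Es i k /\ x k != 0 & nth set0 Es j k' /\ x k' != 0] >].

Lemma not_split Es x : (0 < size Es)%N -> ~~ split_by Es x -> exists2 j, (j < size Es)%N &
  forall k i, x k != 0 -> (i < size Es)%N -> nth set0 Es i k -> i = j.
Proof.
move=> sz0 /asboolPn ns.
have [[j [k [jsz Ek xk]]]|h] := pselect (exists j k, [/\ (j < size Es)%N, nth set0 Es j k & x k != 0]).
  exists j => // k' i xk' isz Ek'; have [ij|ji|//] := ltngtP i j.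
    by case: ns; exists i, j, k', k.
  by case: ns; exists j, i, k, k'.
by exists 0%N => // k i xk isz Ek; case: h; exists i, k.
Qed.

(** A vector that meets at most one set has pairing at most theta_n, since its part of the
    functional contributes at most 1; a split vector is bounded by 1 and counted in the weight. *)
Lemma pairs_split n Es fs y : (1 <= n)%N -> admissible (F n) Es ->
  (forall i, (i < size Es)%N -> norming F theta (fs i)) ->
  {in unzip1 y, forall x, unit_good x} ->
  all (fun p => 0 <= p.2) y -> weight predT y = 1 ->
  pairs (step_fun theta n Es fs) y <= theta n + weight (split_by Es) y.
Proof.
move=> n1 adm hfs hy /allP y0 y1.
have t0 := ltW (theta_gt0 theta01 n1).
have -> : theta n + weight (split_by Es) y =
    \sum_(p <- y) (p.2 * theta n + (if split_by Es p.1 then p.2 else 0)).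
  rewrite big_split /= -mulr_suml -/(weight predT y) y1 mul1r.
  by rewrite /weight big_mkcond.
rewrite /pairs [leLHS]big_seq [leRHS]big_seq; apply: ler_sum => p py.
have p0 := y0 _ py; have gp : unit_good p.1 by apply: hy; apply: map_f.
have hf : norming F theta (step_fun theta n Es fs) by apply: norming_step.
case: ifPn => sp.
  apply: le_trans (_ : p.2 <= _); last by rewrite lerDr mulr_ge0.
  by rewrite -[leRHS]mulr1 ler_wpM2l // pair1_le1.
rewrite addr0 ler_wpM2l //; have sz0 : (0 < size Es)%N by case: adm.
have [j jsz only] := not_split sz0 sp.
apply: le_trans (pair1_only n1 adm jsz (hfs j jsz) only) _.
by rewrite -[leRHS]mulr1 ler_wpM2l // pair1_le1 //; apply: hfs.
Qed.

(** If x meets two of the sets, the minimum of the later one lies between a support point of x and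
    its last support point. *)
Lemma split_hits n Es (w : seq vec) : admissible (F n) Es -> blocks supp maxsupp w ->
  F n [set` map maxsupp (filter (split_by Es) w)].
Proof.
move=> [_ fin disj Fm] bw; apply: (hit_family (regular_near (F_reg n)) Fm bw).
move=> x xw /asboolP[i [j [k [k' [ij jsz [Ek xk] [Ek' xk']]]]]].
have ex : exists k, k \in nth set0 Es j by exists k'; rewrite inE.
have hm : is_min_of (nth set0 Es j) (ex_minn ex).
  case: ex_minnP => m; rewrite inE => Em hm; split => // z Ez; apply: hm; by rewrite inE.
exists (ex_minn ex), k; split => //.
- by exists j.
- by apply: ltnW; apply: (disj i j) => //; exact: hm.1.
- by apply: leq_trans (hm.2 _ Ek') _; apply: (bw.1 x xw).2.
Qed.

Definition ysupp (y : seq (vec * R)) : set nat :=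
  [set k | exists2 x, x \in unzip1 y & x k != 0].

Definition ymax (y : seq (vec * R)) : nat := maxsupp (last (fun=> 0) (unzip1 y)).

Lemma blocks_flatten (ys : seq (seq (vec * R))) : {in ys, forall y, y != [::]} ->
  blocks supp maxsupp (flatten (map unzip1 ys)) -> blocks ysupp ymax ys.
Proof.
have blk1 y : y != [::] -> blocks supp maxsupp (unzip1 y) -> good ysupp ymax y.
  case/lastP: y => [//|y p] _; rewrite /good /ymax /unzip1 map_rcons last_rcons.
  move=> [h1 h2]; split.
    exists p.1; first by rewrite /unzip1 map_rcons mem_rcons mem_head.
    by case: (h1 p.1) => //; rewrite mem_rcons mem_head.
  move=> k [x]; rewrite /unzip1 map_rcons mem_rcons inE => /orP[/eqP-> xk|xy xk].
    by have [|_] := h1 p.1; [rewrite mem_rcons mem_head|apply].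
  move: h2; rewrite pairwise_rcons => /andP[/allP/(_ x xy)/asboolP hb _].
  have [|_ hx] := h1 x; first by rewrite mem_rcons inE xy orbT.
  have [|hp _] := h1 p.1; first by rewrite mem_rcons mem_head.
  by apply: leq_trans (hx _ xk) _; apply: ltnW; apply: hb.
elim: ys => [|y ys IH] ne //= bl.
have b1 : blocks supp maxsupp (unzip1 y) by apply: blocks_subseq bl; apply: prefix_subseq.
have b2 : blocks supp maxsupp (flatten (map unzip1 ys)).
  by apply: blocks_subseq bl; apply: suffix_subseq.
have [h1 h2] := IH (fun z zy => ne z (mem_behead (s := y :: ys) zy)) b2.
have ne1 : y != [::] by apply: ne; rewrite mem_head.
split.
  by move=> z; rewrite inE => /orP[/eqP->|/h1//]; apply: blk1.
rewrite /= h2 andbT; apply/allP => z zys; apply/asboolP => k [x xz xk].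
move: bl.2; rewrite pairwise_cat => /and3P[/allrelP hb _ _].
have /asboolP : before supp maxsupp (last (fun=> 0) (unzip1 y)) x.
  apply: hb; last by apply/flattenP; exists (unzip1 z) => //; apply: map_f.
  case: (y) ne1 => //= p y' _; exact: mem_last.
by apply.
Qed.

End Vectors.

(** * Averages of averages in an l^1 tree of order a * a *)

Section Upper.
Variables (R : realType) (F : nat -> nfamily) (theta : nat -> R) (alpha : nat -> Ord) (xi : Ord).
Hypothesis F_reg : forall n, regular (F n).
Hypothesis F_S0 : forall n, S0 `<=` F n.
Hypothesis theta01 : forall n, (1 <= n)%N -> 0 < theta n < 1.
Hypothesis theta_le_1st : forall n, (1 <= n)%N -> theta n <= theta 1%N.
Hypothesis theta_small : forall e : R, 0 < e ->
  exists2 M, (1 <= M)%N & forall n, (M <= n)%N -> theta n < e.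
Hypothesis F_iota : forall n, iota_is (F n) (alpha n).
Hypothesis xi0 : ~ ole xi OZ.
Let a := opow (opow xi).
Hypothesis alpha_lt : forall n, olt (alpha n) a.
Local Notation vec := (nat -> R).
Local Notation N := (mt_norm F theta).
Local Notation norming := (norming F theta).
Local Notation unit_good := (unit_good F theta).

Let F_near n : near_regular (F n) := regular_near (F_reg n).
Let F_closed n : subseq_closed [set s | F n [set` s]].
Proof. by have [_ h _] := F_near n; apply: hereditary_subseq. Qed.

Definition norming_at (n : nat) (f : vec) : Prop := exists Es fs,
  [/\ admissible (F n) Es, (forall i, (i < size Es)%N -> norming (fs i)) &
      f = step_fun theta n Es fs].

Lemma pairs_at_l1 n f y : (1 <= n)%N -> norming_at n f -> all (fun p => 0 <= p.2) y ->
  pairs f y <= theta n * \sum_(p <- y) p.2 * l1 (maxsupp p.1).+1 p.1.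
Proof.
move=> n1 [Es [fs [adm hfs ->]]] /allP y0.
rewrite /pairs mulr_sumr [leLHS]big_seq [leRHS]big_seq; apply: ler_sum => p py.
rewrite mulrCA ler_wpM2l ?y0 // mulr_sumr; apply: ler_sum => k _.
rewrite ler_wpM2r //; have t0 := ltW (theta_gt0 theta01 n1).
rewrite /step_fun; case: (adm_cases R k adm) => [[i [isz ki ->]]|[_ ->]].
  by rewrite -[leRHS]mulr1 ler_wpM2l // (norming_le1 theta01 _ (hfs i isz)).
by rewrite mulr0.
Qed.

(** Designed to contain the index sets on which a functional is large: r bounds the depth at which
    it can stay large, and only operations with index below N0 need to be composed. *)
Fixpoint big_family (N0 r : nat) : set (seq nat) :=
  if r is r'.+1 then
    [set h | F 0%N [set` h] \/ exists2 n, (n < N0)%N &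
       (0 < n)%N /\ comb (F n) (cons_family (big_family N0 r')) h]
  else [set h | h = [::]].

Lemma big_family_closed N0 r : subseq_closed (big_family N0 r).
Proof.
elim: r => [|r IH] s s' ss /=; first by move=> E; move: ss; rewrite E subseq0 => /eqP.
case=> [h|[n nN [n0 h]]]; first by left; apply: (F_closed ss h).
right; exists n => //; split => //.
by apply: subseq_closed_comb ss h; apply: subseq_closed_cons.
Qed.

Lemma big_family_ranked N0 r : exists2 b, olt b a & ranked (big_family N0 r) b.
Proof.
elim: r => [|r [b ba rb]].
  exists (alpha 0%N) => //; exists (fun=> alpha 0%N) => // s k _ /= /(congr1 size).
  by rewrite size_rcons.
apply: (ranked_bigcup (Q := fun b => olt b a) (H0 := [set s | F 0%N [set` s]])
  (H := fun n => [set h | (0 < n)%N /\ comb (F n) (cons_family (big_family N0 r)) h])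
  (b0 := alpha 0%N)) => //.
- move=> n s s' ss [n0 h]; split => //.
  by apply: subseq_closed_comb ss h; apply: subseq_closed_cons; apply: big_family_closed.
- exact: iota_ranked.
- move=> n _; exists (omul (OS b) (alpha n)).
    by apply: opow_opow_mul_closed => //; apply: opow_opow_succ_closed.
  apply: (@ranked_sub _ (comb (F n) (cons_family (big_family N0 r)))); first by move=> s [].
  apply: ranked_comb => //.
  + by apply: subseq_closed_cons; apply: big_family_closed.
  + exact: iota_ranked.
  + exact: ranked_cons.
Qed.

Section Thresholds.
Variables (C : R) (N0 : nat).
Hypothesis C0 : 0 < C.

(** This tames the operations of large index: with outermost index at least N0, a functional exceeds
    C on at most one of a pairwise apart list of averages. *)
Definition apart (y y' : seq (vec * R)) : bool :=
  `[< forall n f, (N0 <= n)%N -> norming_at n f -> ~ (C < pairs f y /\ C < pairs f y') >].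

Definition convex (y : seq (vec * R)) : Prop :=
  all (fun p => 0 <= p.2) y /\ weight predT y = 1.

Lemma pairs_only n Es fs j (y : seq (vec * R)) : (1 <= n)%N -> admissible (F n) Es ->
  (j < size Es)%N -> norming (fs j) -> all (fun p => 0 <= p.2) y ->
  meets_only (@ysupp R) Es j y ->
  pairs (step_fun theta n Es fs) y <= theta n * pairs (fs j) y.
Proof.
move=> n1 adm jsz fj /allP y0 /asboolP only; rewrite /pairs mulr_sumr.
rewrite [leLHS]big_seq [leRHS]big_seq; apply: ler_sum => p py.
rewrite mulrCA ler_wpM2l ?y0 //; apply: (pair1_only theta01 n1 adm jsz fj).
by move=> k i xk; apply: only; exists p.1 => //; apply: map_f.
Qed.

Lemma pairs_hits f y : norming f -> all (fun p => 0 <= p.2) y -> 0 < pairs f y ->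
  exists k, ysupp y k /\ f k != 0.
Proof.
move=> hf y0 h; apply: contrapT => hno; move: h; rewrite /pairs big_seq big1 ?ltxx //.
move=> p py; rewrite /pair1 /pairing big1 ?mulr0 // => k _.
have [->|fk] := eqVneq (f k) 0; first by rewrite mul0r.
have [->|xk] := eqVneq (p.1 k) 0; first by rewrite normr0 mulr0.
by case: hno; exists k; split => //; exists p.1 => //; apply: map_f.
Qed.

(** Induction on r. Passing to the parts of f divides the threshold by theta_n, and at threshold 1
    no average is large. A base functional hits a member of F_0, an outermost index at least N0
    leaves at most one average by [apart], and a smaller index is handled by [comb_family]. *)
Lemma large_indices r C' f (ys : seq (seq (vec * R))) : C <= C' -> theta 1%N ^+ r <= C' ->
  norming f -> blocks (@ysupp R) (@ymax R) ys ->
  {in ys, forall y, convex y /\ {in unzip1 y, forall x, unit_good x}} ->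
  pairwise apart ys ->
  big_family N0 r (map (@ymax R) (filter (fun y => C' < pairs f y) ys)).
Proof.
move=> CC' hr hf bys hys pap.
elim: r C' CC' hr f hf => [|r IH] C' CC' hr f hf.
  suff -> : filter (fun y => C' < pairs f y) ys = [::] by [].
  apply/eqP; rewrite -[_ == _]negbK -has_filter; apply/hasPn => y /hys[[y0 y1] hy].
  by rewrite -leNgt; apply: le_trans hr; apply: (pairs_le1 F_reg F_S0 theta01).
have C'0 : 0 < C' := lt_le_trans C0 CC'.
case: hf (hf) => [A FA|n Es fs n1 adm hfs] hf; first left.
  apply: (hit_family (F_near 0%N) FA bys) => y yys Cy.
  have [[y0 _] _] := hys y yys.
  have [k [yk fk]] := pairs_hits hf y0 (lt_trans C'0 Cy).
  exists k, k; split => //; last by apply: (bys.1 y yys).2.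
  by move: fk; case: (boolP (k \in A)); rewrite ?inE ?eqxx.
have [nN|nN] := ltnP n N0; last first.
  left; set l := filter _ _.
  suff : (size l <= 1)%N.
    case: l => [|y [|//]] _ /=; first by rewrite set_nil; apply: F_nil.
    apply: F_S0; right; exists (ymax y); apply/seteqP; split => x /=; rewrite inE.
      by move/eqP.
    by move=> ->.
  have hl : {in l, forall y, C' < pairs (step_fun theta n Es fs) y}.
    by move=> y; rewrite mem_filter => /andP[].
  have : pairwise apart l by apply: subseq_pairwise pap; apply: filter_subseq.
  case: (l) hl => [|y [|y' l']] //= hl /andP[/andP[/asboolP ap _] _].
  case: (ap n (step_fun theta n Es fs) nN); first by exists Es, fs.
  by split; apply: le_lt_trans CC' _; apply: hl; rewrite !inE eqxx ?orbT.
right; exists n => //; split => //.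
have t0 := theta_gt0 theta01 n1; have t1 := theta_le1 theta01 n1.
apply: (comb_family (F_near n) adm bys (@big_family_closed N0 r)).
  move=> y yys Cy; have [[y0 _] _] := hys y yys.
  have [k [yk]] := pairs_hits hf y0 (lt_trans C'0 Cy).
  rewrite /step_fun; case: (adm_cases R k adm) => [[i [isz ki _]] _|[_ ->]].
    by exists i, k; split => //; move: ki; rewrite inE.
  by rewrite mulr0 eqxx.
move=> j jsz.
apply: (@big_family_closed N0 r (map (@ymax R) (filter (fun y => C' / theta n < pairs (fs j) y) ys))).
  apply: map_subseq; apply: subseq_filter_imp => y yys /andP[Cy only].
  have [[y0 _] _] := hys y yys.
  rewrite ltr_pdivrMr // mulrC; apply: lt_le_trans Cy _.
  exact: (pairs_only n1 adm jsz (hfs j jsz) y0 only).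
apply: IH; last exact: hfs.
  by apply: le_trans CC' _; rewrite ler_pdivlMr // -[leRHS]mulr1 ler_wpM2l // ltW.
rewrite ler_pdivlMr //; apply: le_trans hr; rewrite exprSr ler_wpM2l ?theta_le_1st //.
by apply: exprn_ge0; apply/ltW/(theta_gt0 theta01).
Qed.

End Thresholds.

Section Tree.
Variables (K : R) (T : set (seq vec)).
Hypothesis K0 : 0 < K.
Hypothesis hT : l1K_tree N K T.

Let T_take t n : T t -> (0 < n)%N -> (n <= size t)%N -> T (take n t).
Proof. by case: hT => _ h _; apply: h. Qed.

Lemma tree_blocks t : T t -> {in t, forall x, unit_good x} /\ blocks (@supp R) (@maxsupp R) t.
Proof.
case: hT => _ _ h /h[h1 h2 _].
have g : {in t, forall x, unit_good x}.
  move=> x /(nthP (fun=> 0))[i isz <-]; have [f1 f2] := h1 i isz.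
  by split => //; apply: (good_vec F_reg F_S0 theta01).
split => //; split; first by move=> x /g[].
apply/(pairwiseP (fun=> 0)) => i j; rewrite !inE => isz jsz ij; apply/asboolP => k xk.
apply: (h2 i j) => //; have [[+ _] _] := g (nth (fun=> 0) t i) (mem_nth _ isz).
exact.
Qed.

(** The l^1 estimate of the node is applied with coefficient 0 on [t0] and the given weights on the
    rest. *)
Lemma tree_lower t0 (ws : seq (vec * R)) : T (t0 ++ unzip1 ws) ->
  all (fun p => 0 <= p.2) ws -> weight predT ws = 1 ->
  K^-1 <= N (fun k => \sum_(p <- ws) p.2 * p.1 k).
Proof.
case: hT => _ _ h /h[_ _ h3] w0 w1.
pose c := fun i => nth 0 (nseq (size t0) 0 ++ unzip2 ws) i.
have cl i : (i < size t0)%N -> c i = 0.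
  by move=> isz; rewrite /c nth_cat size_nseq isz nth_nseq isz.
have cr i : c (size t0 + i)%N = nth 0 (unzip2 ws) i.
  by rewrite /c nth_cat size_nseq ltnNge leq_addr /= addKn.
have szE : size (t0 ++ unzip1 ws) = (size t0 + size ws)%N.
  by rewrite size_cat size_map.
have sumE (g : vec -> R -> R) : (forall x, g x 0 = 0) ->
    \sum_(i < size (t0 ++ unzip1 ws)) g (nthv (t0 ++ unzip1 ws) i) (c i) = \sum_(p <- ws) g p.1 p.2.
  move=> g0; rewrite szE big_split_ord /= big1 ?add0r => [|i _]; last by rewrite cl.
  rewrite (big_nth ((fun=> 0), 0)) big_mkord; apply: eq_bigr => i _.
  rewrite cr /nthv nth_cat ltnNge leq_addr /= addKn.
  by rewrite (nth_map ((fun=> 0), 0)) // (nth_map ((fun=> 0), 0)).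
have := h3 c; rewrite (sumE (fun _ r => `|r|)) ?normr0 //.
have -> : \sum_(p <- ws) `|p.2| = 1.
  rewrite -w1 /weight big_seq [RHS]big_seq; apply: eq_bigr => p pw.
  by rewrite ger0_norm //; move/allP: w0; apply.
rewrite mulr1; congr (_ <= N _); apply: funext => k.
by rewrite (sumE (fun x r => r * x k)) // => x; rewrite mul0r.
Qed.

Let D nu := oiter (@tree_deriv R) T nu.
Variable t0 : seq vec.
Hypothesis ht0 : D (omul a a) t0.
(** The final average will have norm at most 2 * C, which is less than 1 / K. *)
Let C := K^-1 / 3.

Let C0 : 0 < C. Proof. by rewrite divr_gt0 // invr_gt0. Qed.

Variable N0 : nat.
Hypothesis N01 : (1 <= N0)%N.
Hypothesis theta_N0 : forall n, (N0 <= n)%N -> theta n < C / 2.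

Let flat (ys : seq (seq (vec * R))) : seq vec := flatten (map unzip1 ys).

(** Each average uses up order a of the tree, so nu counts the remaining order in units of a. *)
Definition outer (nu : Ord) : set (seq (seq (vec * R))) :=
  [set ys | [/\ D (omul a nu) (t0 ++ flat ys), {in ys, forall y, convex y} &
    pairwise (apart C N0) ys]].

Let D_T nu t : D nu t -> T t.
Proof. by apply: oiter_sub; exact: tree_deriv_sub. Qed.

(** N1 depends on the averages already built: for n >= N1 their l^1 mass times theta_n stays below
    C. The new average gives weight at most C / 2 to the vectors split by F_n with n < N1, so for N0
    <= n < N1 its pairing is below theta_n + C / 2 or equal to it, hence below C. *)
Lemma outer_step nu ys : outer (OS nu) ys -> exists y, outer nu (rcons ys y).
Proof.
move=> [hD hc hp].
have [bd hbd] : exists M : R, 0 <= M /\ forall y, y \in ys ->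
    \sum_(p <- y) p.2 * l1 (maxsupp p.1).+1 p.1 <= M.
  elim: (ys) hc => [|y ys' IH] hc; first by exists 0.
  have [M [M0 hM]] := IH (fun z zy => hc z (mem_behead (s := y :: ys') zy)).
  pose s := \sum_(p <- y) p.2 * l1 (maxsupp p.1).+1 p.1.
  have s0 : 0 <= s.
    have [/allP y0 _] := hc y (mem_head _ _); rewrite /s big_seq; apply: sumr_ge0 => p py.
    by apply: mulr_ge0; [apply: y0|apply: l1_ge0].
  exists (s + M); split; first exact: addr_ge0.
  move=> z; rewrite inE => /orP[/eqP->|/hM h]; first by rewrite lerDl.
  by apply: le_trans h _; rewrite lerDr.
case: hbd => bd0 hbd.
have e0 : 0 < C / (bd + 1) by rewrite divr_gt0 // ltr_pwDr.
have [N1 N11 hN1] := theta_small e0.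
pose HF := [set s : seq nat | F 0%N [set` s] \/ exists2 n, (n < N1)%N & F n [set` s]].
have [b ba [phi phi0 phid]] : exists2 b, olt b a & ranked HF b.
  apply: (ranked_bigcup (Q := fun b => olt b a) (H0 := [set s | F 0%N [set` s]]) (H := fun n => [set s | F n [set` s]]) (b0 := alpha 0%N)) => //.
  - exact: iota_ranked.
  - by move=> n _; exists (alpha n) => //; apply: iota_ranked.
have HF_closed : subseq_closed HF.
  move=> s s' ss [h|[n nN h]]; first by left; apply: (F_closed ss h).
  by right; exists n => //; apply: (F_closed ss h).
pose L rho := [set w : seq vec | D (oadd (omul a nu) rho) ((t0 ++ flat ys) ++ w)].
pose H := [set h : seq vec | sorted ltn (map (@maxsupp R) h) /\ HF (map (@maxsupp R) h)].
have [| | | | | | |w [w0 w1 hL hw]] := @small_average R vec L H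
  (fun h => phi (map (@maxsupp R) h)) _ _ _ _ (opow xi) OZ (C / 2).
- move=> rho s hs; have [v hv] := oiter_tree_step T_take hs.
  by exists v; rewrite /L /= -rcons_cat.
- by move=> f n s hs; exact: (hs n).
- move=> h v []; rewrite map_rcons => srt hh; split.
    by apply: (subseq_sorted ltn_trans _ srt); apply: subseq_rcons.
  by apply: HF_closed hh; apply: subseq_rcons.
- by move=> h v []; rewrite map_rcons => srt hh; apply: phid.
- by rewrite divr_gt0.
- by rewrite oadd0l /L /= cats0.
- exact: ole_lt_trans phi0 ba.
rewrite /L /= in hL.
have hTw := D_T hL; have [gw bw] := tree_blocks hTw.
have gw' : {in unzip1 w, forall x, unit_good x}.
  by move=> x xw; apply: gw; rewrite mem_cat xw orbT.
have bw' : blocks (@supp R) (@maxsupp R) (unzip1 w).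
  by apply: blocks_subseq bw; apply: suffix_subseq.
exists w; split.
- by rewrite /flat map_rcons flatten_rcons catA.
- by move=> y; rewrite mem_rcons inE => /orP[/eqP->|/hc//].
rewrite pairwise_rcons hp andbT; apply/allP => y yys; apply/asboolP => n f nN hf [Cy Cw].
have n1 : (1 <= n)%N by apply: leq_trans nN.
have [nN1|nN1] := ltnP n N1; last first.
  have := pairs_at_l1 n1 hf (hc y yys).1; rewrite leNgt => /negP; apply.
  apply: le_lt_trans Cy; apply: le_trans (ler_wpM2l (ltW (theta_gt0 theta01 n1)) (hbd y yys)) _.
  have tb : theta n * (bd + 1) < C by rewrite -ltr_pdivlMr ?hN1 // ltr_pwDr.
  have := ltW (theta_gt0 theta01 n1); lra.
case: hf => Es [fs [adm hfs fE]]; move: Cw; rewrite fE ltNge => /negP; apply.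
apply: le_trans (pairs_split F_reg F_S0 theta01 n1 adm hfs gw' w0 w1) _.
have : weight (split_by Es) w <= C / 2.
  apply: hw; split; last first.
    by right; exists n => //; apply: (split_hits F_reg).
  by apply: blocks_sorted; apply: blocks_subseq bw'; apply: filter_subseq.
have := theta_N0 nN; lra.
Qed.

(** A second averaging, now along the list of averages and against [big_family], gives a convex
    combination of a node with norm at most 2 * C, against the lower estimate 3 * C. *)
Lemma outer_empty : False.
Proof.
have [r hr] : exists r, theta 1%N ^+ r <= C.
  have /andP[t0' t1] := theta01 (leqnn 1).
  have /cvgrPdist_lt /(_ C C0) [M _ hM] : (fun n => theta 1%N ^+ n) @ \oo --> (0 : R).
    by apply: cvg_expr; rewrite ger0_norm // ltW.
  exists M; have := hM M (leqnn M); rewrite /= sub0r normrN ger0_norm; first exact: ltW.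
  by apply: exprn_ge0; apply: ltW.
have [b ba [phi phi0 phid]] := big_family_ranked N0 r.
pose H := [set h : seq (seq (vec * R)) | sorted ltn (map (@ymax R) h) /\ big_family N0 r (map (@ymax R) h)].
have [| | | | | | |w [w0 w1 hL hw]] := @small_average R _ outer H
  (fun h => phi (map (@ymax R) h)) _ _ _ _ (opow xi) OZ C.
- exact: outer_step.
- by move=> f n s [h1 h2 h3]; split => //; exact: (h1 n).
- move=> h v []; rewrite map_rcons => srt hh; split.
    by apply: (subseq_sorted ltn_trans _ srt); apply: subseq_rcons.
  by apply: big_family_closed hh; apply: subseq_rcons.
- by move=> h v []; rewrite map_rcons => srt hh; apply: phid.
- exact: C0.
- by rewrite oadd0l; split; rewrite // /flat /= cats0.
- exact: ole_lt_trans phi0 ba.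
case: hL => hD hc hp.
have hTw := D_T hD; have [gw bw] := tree_blocks hTw.
have gy : {in unzip1 w, forall y, convex y /\ {in unzip1 y, forall x, unit_good x}}.
  move=> y yw; split; first exact: hc.
  move=> x xy; apply: gw; rewrite mem_cat; apply/orP; right.
  by apply/flattenP; exists (unzip1 y) => //; apply: map_f.
have by_ : blocks (@ysupp R) (@ymax R) (unzip1 w).
  apply: blocks_flatten; last by apply: blocks_subseq bw; apply: suffix_subseq.
  move=> y /hc[_ y1]; apply/eqP => y0; move: y1; rewrite y0 /weight big_nil.
  by move/esym/eqP; rewrite oner_eq0.
(* The average of averages is rewritten as one convex combination of tree vectors by multiplying the
   weights. *)
pose ws := flatten [seq [seq (p.1, yb.2 * p.2) | p <- yb.1] | yb <- w].
have uws : unzip1 ws = flat (unzip1 w).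
  rewrite /ws /flat /unzip1 map_flatten -!map_comp; congr flatten; apply: eq_map => yb /=.
  by rewrite -map_comp; apply: eq_map.
have sumws (g : vec -> R) : \sum_(p <- ws) p.2 * g p.1 =
    \sum_(yb <- w) yb.2 * \sum_(p <- yb.1) p.2 * g p.1.
  rewrite /ws big_flatten big_map; apply: eq_bigr => yb _; rewrite big_map mulr_sumr.
  by apply: eq_bigr => p _; rewrite mulrA.
have ws0 : all (fun p => 0 <= p.2) ws.
  apply/allP => q /flattenP[s /mapP[yb ybw ->] /mapP[p pyb ->]] /=.
  apply: mulr_ge0; first by move/allP: w0; apply.
  by have [/allP y0 _] := hc yb.1 (map_f _ ybw); apply: y0.
have ws1 : weight predT ws = 1.
  have sum1 (y : seq (vec * R)) : \sum_(p <- y) p.2 * 1 = weight predT y.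
    by apply: eq_bigr => p _; rewrite mulr1.
  rewrite -sum1 (sumws (fun=> 1)) -[RHS]w1 /weight big_seq [RHS]big_seq.
  apply: eq_bigr => yb ybw; rewrite sum1.
  by have [_ ->] := hc yb.1 (map_f _ ybw); rewrite mulr1.
have low := @tree_lower t0 ws; rewrite uws in low.
have {}low := low hTw ws0 ws1.
suff up : N (fun k => \sum_(p <- ws) p.2 * p.1 k) <= 2 * C.
  have := le_trans low up; rewrite /C => h; have : 0 < K^-1 by rewrite invr_gt0.
  by move=> K10; lra.
have gws : {in ws, forall p, unit_good p.1}.
  move=> p pw; apply: gw; rewrite mem_cat; apply/orP; right; rewrite -/(flat _) -uws.
  exact: map_f.
pose B := (\max_(p <- ws) maxsupp p.1).+1.
have leB p : p \in ws -> ((maxsupp p.1).+1 <= B)%N.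
  by move=> pw; rewrite ltnS; apply: (leq_bigmax_seq _ pw).
have suppB p : p \in ws -> supp_lt B p.1.
  move=> pw k Bk; have [g1 _] := gws p pw; apply: (good_supp_lt g1).
  exact: leq_trans (leB _ pw) Bk.
apply: (mt_norm_le F_reg F_S0 theta01 (B := B)) => [k Bk|f hf].
  by rewrite big_seq big1 // => p pw; rewrite suppB // mulr0.
apply: (@le_trans _ _ (\sum_(p <- ws) p.2 * pair1 f p.1)).
  rewrite /pairing; apply: (@le_trans _ _ (\sum_(k < B) \sum_(p <- ws) p.2 * (f k * `|p.1 k|))).
    apply: ler_sum => k _; apply: (@le_trans _ _ (f k * \sum_(p <- ws) p.2 * `|p.1 k|)).
      apply: ler_wpM2l; first exact: (norming_ge0 theta01 _ hf).
      apply: le_trans (ler_norm_sum _ _ _) _; rewrite [leLHS]big_seq [leRHS]big_seq.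
      apply: ler_sum => p pw; rewrite normrM ler_wpM2r // ger0_norm //.
      by move/allP: ws0; apply.
    by rewrite mulr_sumr; apply: ler_sum => p _; rewrite mulrCA.
  rewrite exchange_big /= [leLHS]big_seq [leRHS]big_seq; apply: ler_sum => p pw.
  rewrite -mulr_sumr -/(pairing B f p.1) (pairing_widen _ (leB p pw)) //.
  by apply: good_supp_lt; case: (gws p pw).
rewrite sumws -/(pairs f).
(* The averages with pairing above C have total weight at most C and pairing at most 1; the others
   contribute at most C. *)
pose P y := C < pairs f y.
apply: (@le_trans _ _ (weight P w + C)); last first.
  rewrite [2 * C]mulrDl !mul1r lerD2r; apply: hw; split.
    by apply: blocks_sorted; apply: blocks_subseq by_; apply: filter_subseq.
  exact: (large_indices C0 (lexx C) hr hf by_ gy hp).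
have -> : weight P w + C = \sum_(yb <- w) ((if P yb.1 then yb.2 else 0) + yb.2 * C).
  by rewrite big_split /= -mulr_suml -/(weight predT w) w1 mul1r /weight big_mkcond.
rewrite [leLHS]big_seq [leRHS]big_seq; apply: ler_sum => yb ybw.
have yb0 : 0 <= yb.2 by move/allP: w0; apply.
rewrite -/(pairs f yb.1); case: ifPn => [_|/negbTE Py].
  have [[y0 y1] hy] := gy yb.1 (map_f _ ybw).
  apply: (@le_trans _ _ yb.2); last by rewrite lerDl mulr_ge0 // ltW.
  by rewrite -[leRHS]mulr1 ler_wpM2l // (pairs_le1 F_reg F_S0 theta01).
by rewrite add0r ler_wpM2l // leNgt -/(P yb.1) Py.
Qed.

End Tree.

Lemma upper_bound K T : 0 < K -> l1K_tree N K T ->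
  oiter (@tree_deriv R) T (opow (omul (opow xi) otwo)) = set0.
Proof.
move=> K0 hT; rewrite /= oadd0l opowD -/a -subset0 => t ht.
have e0 : 0 < K^-1 / 3 / 2 by rewrite !divr_gt0 // invr_gt0.
have [M M1 hM] := theta_small e0.
exact: (outer_empty K0 hT ht M1 hM).
Qed.

End Upper.

(** * The lower bound *)

Section Levels.
Variables (R : realType) (F : nat -> nfamily) (theta : nat -> R) (alpha : nat -> Ord) (xi : Ord).
Hypothesis F_reg : forall n, regular (F n).
Hypothesis F_S0 : forall n, S0 `<=` F n.
Hypothesis theta01 : forall n, (1 <= n)%N -> 0 < theta n < 1.
Hypothesis theta_le_1st : forall n, (1 <= n)%N -> theta n <= theta 1%N.
Hypothesis theta_small : forall e : R, 0 < e ->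
  exists2 M, (1 <= M)%N & forall n, (M <= n)%N -> theta n < e.
Hypothesis F_iota : forall n, iota_is (F n) (alpha n).
Hypothesis alpha_gt1 : forall n, (1 <= n)%N -> olt oone (alpha n).
Hypothesis alpha_mono : forall m n, (1 <= m)%N -> (m <= n)%N -> ole (alpha m) (alpha n).
Hypothesis xi0 : ~ ole xi OZ.
Local Notation a := (opow (opow xi)).
Hypothesis alpha_lt : forall n, olt (alpha n) a.
Local Notation vec := (nat -> R).
Local Notation N := (mt_norm F theta).
Local Notation norming := (norming F theta).

Let F_near n : near_regular (F n) := regular_near (F_reg n).
Let F_hered n : hereditary (F n).
Proof. by case: (F_near n). Qed.
Let F_closed n : subseq_closed [set s | F n [set` s]].
Proof. exact: hereditary_subseq. Qed.

Definition level (c : R) : set (seq nat) :=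
  [set h | exists2 f, norming f & {in h, forall k, c < f k}].

Lemma level_closed c : subseq_closed (level c).
Proof.
by move=> s s' ss [f hf h]; exists f => // k ks; apply: h; apply: (mem_subseq ss).
Qed.

(** Where f exceeds c, its part on the relevant set exceeds c / theta_n, and cutting at the minima
    of the sets separates the parts. Single points cannot straddle a cut, so no extra first element
    has to be allowed here. *)
Lemma level_comb c : 0 < c -> level c `<=`
  [set h | F 0%N [set` h] \/ exists n, [/\ (1 <= n)%N, c < theta n &
     comb (F n) (level (c / theta n)) h]].
Proof.
move=> c0 h [f hf]; case: hf => [A FA|n Es fs n1 adm hfs] hc.
  left; apply: F_hered FA _ => k /= /hc; case: (boolP (k \in A)); first by rewrite inE.
  by move=> _; rewrite ltNge ltW.
(* The empty list goes to F_0, because c < theta_n is read off a point of h. *)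
case: h hc => [|k0 h'] hc; first by left; rewrite set_nil; apply: F_nil.
move: hc; set h := k0 :: h' => hc; right; exists n.
have t0 := theta_gt0 theta01 n1.
have hk k : k \in h -> exists i, [/\ (i < size Es)%N, nth set0 Es i k & c / theta n < fs i k].
  move=> /hc; rewrite /step_fun; case: (adm_cases R k adm) => [[i [isz ki ->]]|[_ ->]].
    by move=> hlt; exists i; split => //; [move: ki; rewrite inE|rewrite ltr_pdivrMr // mulrC].
  by rewrite mulr0 ltNge ltW.
split => //.
  have [|i [isz _ hlt]] := hk k0; first by rewrite mem_head.
  have := lt_le_trans hlt (norming_le1 theta01 _ (hfs i isz)).
  by rewrite ltr_pdivrMr // mul1r.
have [es [szes ses Fes he]] := admissible_mins (@F_hered n) adm.
have [sz0 _ disj _] := adm.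
have lti k i : (i < size Es)%N -> nth set0 Es i k -> (i < cut_index es k)%N.
  by move=> isz Ek; apply: lt_cut_nth; rewrite ?szes //; apply: (he i isz).2.
exists es; split => //.
  by move=> k /hk[i [isz Ek _]]; apply: leq_ltn_trans (lti k i isz Ek).
move=> c'; have key k : k \in filter (fun k => cut_index es k == c') h ->
    (c'.-1 < size Es)%N /\ c / theta n < fs c'.-1 k.
  rewrite mem_filter => /andP[/eqP kc /hk[i [isz Ek hlt]]].
  suff -> : c'.-1 = i by [].
  have ic : (i < c')%N by rewrite -kc lti.
  apply/eqP; rewrite eq_sym eqn_leq -ltnS prednK ?ic; last exact: leq_ltn_trans ic.
  rewrite leqNgt; apply/negP => lt.
  have csz : (c'.-1 < size Es)%N.
    by rewrite prednK ?(leq_ltn_trans _ ic) // -kc -szes count_size.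
  have h1 : (k < nth 0%N es c'.-1)%N by apply: (disj i c'.-1) => //; apply: (he _ csz).1.
  have : (nth 0%N es c'.-1 <= k)%N.
    by apply: nth_lt_cut => //; rewrite kc prednK // (leq_ltn_trans _ ic).
  by rewrite leqNgt h1.
have [csz|csz] := ltnP c'.-1 (size Es).
  by exists (fs c'.-1); [exact: hfs|move=> k /key[]].
by exists (fs 0%N); [exact: hfs|move=> k /key[]; rewrite ltnNge csz].
Qed.

(** The functional is unfolded through its outermost operations. Only finitely many n have theta_n >
    c, the depth is bounded by r, and the rank of a finite union is that of one branch, hence a
    single product. *)
Lemma level_ranked r c : 0 < c < 1 -> theta 1%N ^+ r <= c -> exists l : seq nat,
  [/\ all (fun n => (0 < n)%N) l, c < \prod_(n <- l) theta n &
      ranked (level c) (aprod alpha l)].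
Proof.
elim: r c => [|r IH] c /andP[c0 c1] hr; first by rewrite expr0 leNgt c1 in hr.
have [N0 _ hN0] := theta_small c0.
pose Q b := exists l, [/\ all (fun n => (0 < n)%N) l, c < \prod_(n <- l) theta n & b = aprod alpha l].
pose H n := [set h | [/\ (1 <= n)%N, c < theta n & comb (F n) (level (c / theta n)) h]].
have Q0 : Q (alpha 0%N) by exists [::]; rewrite big_nil.
have cH n : subseq_closed (H n).
  by move=> s s' ss [h1 h2 h3]; split => //; apply: subseq_closed_comb h3 => //; apply: level_closed.
have [||b [l [l0 cl ->]] rk] := @ranked_bigcup Q [set s | F 0%N [set` s]] H N0 (alpha 0%N)
    (@F_closed 0%N) cH Q0.
- exact: iota_ranked.
- move=> n _; have [/andP[n1 cn]|hn] := boolP ((1 <= n)%N && (c < theta n)); last first.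
    exists (alpha 0%N) => //; apply: ranked_sub (ranked0 _) => s [h1 h2 _].
    by rewrite h1 h2 in hn.
  have t0 := theta_gt0 theta01 n1.
  have [||l [l0 cl rk]] := IH (c / theta n).
  + by rewrite divr_gt0 //= ltr_pdivrMr // mul1r.
  + rewrite ler_pdivlMr //; apply: le_trans hr; rewrite exprSr ler_wpM2l ?theta_le_1st //.
    by apply: exprn_ge0; apply/ltW/(theta_gt0 theta01).
  exists (aprod alpha (n :: l)).
    exists (n :: l); split => //=; first by rewrite n1.
    by rewrite big_cons mulrC -ltr_pdivrMr.
  apply: (@ranked_sub _ (comb (F n) (level (c / theta n)))); first by move=> s [].
  apply: ranked_comb => //; first exact: level_closed.
  exact: iota_ranked.
exists l; split => //; apply: ranked_sub rk => h /(level_comb c0)[h0|[n [n1 cn hn]]]; first by left.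
right; exists n => //.
by rewrite ltnNge; apply/negP => /hN0; rewrite ltNge (ltW cn).
Qed.

Lemma alpha0_ge1 : ole oone (alpha 0%N).
Proof.
have [//|/ole_OS h] := ole_or_lt oone (alpha 0%N).
have F00 : F 0%N [set 0%N] by apply: F_S0; right; exists 0%N.
have : oiter cb_deriv (F 0%N) (alpha 0%N) [set 0%N].
  exact: (oiter_anti cb_deriv_sub cb_deriv_mono h (A := F 0%N) F00).
rewrite (F_iota 0%N) /= => E; have : [set 0%N] 0%N by [].
by rewrite E.
Qed.

Lemma aprod_ge1 l : all (fun n => (0 < n)%N) l -> ole oone (aprod alpha l).
Proof.
elim: l => [_|n l IH] /=; first exact: alpha0_ge1.
move=> /andP[n0 /IH h]; apply: ole_trans h (ole_mull _ _).
exact: oltW (alpha_gt1 n0).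
Qed.

Variable eps : R.
Hypothesis eps0 : 0 < eps.
Hypothesis gap : forall beta, olt beta (opow xi) ->
  exists m, (1 <= m)%N /\ exists g L,
    [/\ gamma_is alpha theta eps m g, ell_is (alpha m) L &
        olt (oadd (oadd g otwo) beta) L].

(** The exponent is eta = g + 2. The rank of the level family has leading exponent at most g, while
    the gap puts alpha_m above omega^(g + 2) * omega^b. *)
Lemma selection b : olt b (opow xi) -> exists m eta bm, [/\ (1 <= m)%N,
  oiter cb_deriv (F m) (omul (opow eta) (opow b)) set0,
  olt bm (opow eta) & ranked (level (theta m / eps)) bm].
Proof.
move=> hb; have e1 : 0 < eps * theta 1%N by rewrite mulr_gt0 // (theta_gt0 theta01).
have [M M1 hM] := theta_small e1.
(* The gap is used at the maximum of b and b1, where alpha_M < omega^b1. This forces m >= M and so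
   theta_m / eps < theta_1. *)
have [b1 hb1 aM] := olt_opow_opow xi0 (alpha_lt M).
have hmax : olt (omax b b1) (opow xi) by apply: (@omax_ind (fun x => olt x (opow xi))).
have [m [m1 [g [L [[gub _] [L1 L2] hgap]]]]] := gap hmax.
have Mm : (M <= m)%N.
  rewrite leqNgt; apply/negP => /ltnW mM; case: (olt_nle aM).
  apply: ole_trans (alpha_mono m1 mM); apply: ole_trans L1; apply: ole_opow.
  apply: ole_trans (ole_maxr b b1) _; apply: ole_trans (ole_addl _ _) (oltW hgap).
have c1 : theta m / eps < theta 1%N by rewrite ltr_pdivrMr // mulrC hM.
have c0 : 0 < theta m / eps by rewrite divr_gt0 // (theta_gt0 theta01).
have t11 : theta 1%N < 1 by have /andP[] := theta01 (leqnn 1).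
have [r hr] : exists r, theta 1%N ^+ r <= theta m / eps.
  have t10 := theta_gt0 theta01 (leqnn 1).
  have /cvgrPdist_lt /(_ _ c0) [k _ hk] : (fun n => theta 1%N ^+ n) @ \oo --> (0 : R).
    by apply: cvg_expr; rewrite ger0_norm // ltW.
  exists k; have := hk k (leqnn k); rewrite /= sub0r normrN ger0_norm; first exact: ltW.
  by apply: exprn_ge0; apply: ltW.
have [||l0 [l0p l0c l0r]] := @level_ranked r (theta m / eps) => //.
  by rewrite c0 (lt_trans c1).
have [l [lsz lp lc lr]] : exists l : seq nat, [/\ (0 < size l)%N, all (fun n => (0 < n)%N) l,
    theta m / eps < \prod_(n <- l) theta n & ranked (level (theta m / eps)) (aprod alpha l)].
  (* [gamma_set] asks for a nonempty list. An empty one is replaced by [[:: 1]], whose factor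
     theta_1 is still above the threshold and whose rank bound is no smaller. *)
  case: l0 l0p l0c l0r => [|n l] l0p l0c l0r; last by exists (n :: l).
  exists [:: 1%N]; split => //; first by rewrite big_seq1.
  by apply: ranked_le l0r; apply: ole_mull; apply: oltW; apply: alpha_gt1.
have [lam [lam1 lam2]] := ell_exists (aprod_ge1 lp).
have lamg : ole lam g.
  by apply: gub; exists l; split => //; rewrite mulrC -ltr_pdivrMr.
exists m, (OS (OS g)), (aprod alpha l); split => //.
  apply: (oiter_anti cb_deriv_sub cb_deriv_mono (b := alpha m)); last by rewrite (F_iota m).
  apply: ole_trans L1; apply: ole_trans (ole_opow (oltW hgap)).
  by rewrite opowD; apply: ole_mul2l; apply: ole_opow; apply: ole_maxl.
apply: olt_le_trans lam2 _; apply: ole_opow; apply: ole_succ.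
exact: ole_trans lamg (ole_S _).
Qed.

(** The singletons of the points of u form an admissible list, and their indicators are norming as
    F_0 contains all singletons. *)
Lemma norming_indicator m (u : seq nat) : (1 <= m)%N -> F m [set` u] -> sorted ltn u ->
  (0 < size u)%N -> norming (fun k => theta m * (k \in u)%:R).
Proof.
move=> m1 Fu su u0; pose Es := [seq [set k] | k <- u].
have nE i : (i < size u)%N -> nth set0 Es i = [set nth 0%N u i].
  by move=> isz; rewrite (nth_map 0%N).
have szE : size Es = size u by rewrite size_map.
have adm : admissible (F m) Es.
  split; rewrite ?szE //.
  - move=> i isz; rewrite nE //; split => // E0.
    by have : [set nth 0%N u i] (nth 0%N u i) by []; rewrite E0.
  - move=> i j x y ij jsz; rewrite !nE //; last exact: ltn_trans jsz.
    by move=> -> ->; rewrite (sorted_ltn_nth ltn_trans) // inE (ltn_trans ij).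
  - apply: F_hered Fu _ => x [i isz]; rewrite nE // => -[/= -> _]; exact: mem_nth.
pose fs i k : R := (k \in [set nth 0%N u i])%:R.
suff -> : (fun k => theta m * (k \in u)%:R) = step_fun theta m Es fs.
  apply: norming_step => // i; rewrite szE => isz; apply: norming_base.
  by apply: F_S0; right; eexists.
apply: funext => k; rewrite /step_fun; congr (_ * _).
case: (adm_cases R k adm) => [[i [isz ki ->]]|[nk ->]].
  rewrite szE in isz; rewrite nE // in ki; rewrite /fs ki; move: ki; rewrite inE /= => ->.
  by rewrite mem_nth.
case: (boolP (k \in u)) => // /(nthP 0%N)[i isz ik].
by have := nk i; rewrite szE => /(_ isz); rewrite nE // ik mem_set.
Qed.

(** The average x0 of unit vectors gives weight at most c = theta_m / eps to every set {f > c}. Its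
    norm is therefore at most 2 * c and its l^1 mass is 1; normalizing leaves theta_m / (2 * c) =
    eps / 2, whatever m is. *)
Lemma normalized_average m eta bm rho s q : (1 <= m)%N ->
  olt bm (opow eta) -> ranked (level (theta m / eps)) bm -> sorted ltn s ->
  oiter cb_deriv (F m) (omul (opow eta) (OS rho)) [set` s] ->
  exists (x : vec) (w : seq nat), [/\ sorted ltn (s ++ w), {in w, forall k, (q <= k)%N},
    oiter cb_deriv (F m) (omul (opow eta) rho) [set` s ++ w],
    (forall k, 0 <= x k) /\ (forall k, x k != 0 -> k \in w) &
    N x = 1 /\ exists2 B, supp_lt B x & eps / 2 <= theta m * pairing B (fun=> 1) x].
Proof.
move=> m1 hbm [phi phi0 phid] ss hs; set c := theta m / eps.
have tm0 := theta_gt0 theta01 m1.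
have c0 : 0 < c by rewrite divr_gt0.
pose L nu := [set w : seq nat | [/\ sorted ltn (s ++ w), {in w, forall k, (q <= k)%N} &
  oiter cb_deriv (F m) (oadd (omul (opow eta) rho) nu) [set` s ++ w]]].
pose H := [set h | sorted ltn h /\ level c h].
have [| | | | | | |w [w0 w1 [hL1 hL2 hL3] hw]] := @small_average R nat L H phi _ _ _ _ eta OZ c.
- move=> nu w [h1 h2 h3].
  have [k [qk sk Fk]] := oiter_cb_grow q (F_near m) h1 h3.
  exists k; split; [by rewrite -rcons_cat| |by rewrite -rcons_cat].
  by move=> z; rewrite mem_rcons inE => /orP[/eqP->|/h2].
- by move=> f n w [h1 h2 h3]; split => //; exact: (h3 n).
- move=> h v [h1 h2]; split; last by apply: level_closed h2; apply: subseq_rcons.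
  by apply: (subseq_sorted ltn_trans _ h1); apply: subseq_rcons.
- by move=> h v [h1 h2]; apply: phid.
- exact: c0.
- by rewrite oadd0l; split; rewrite ?cats0.
- exact: ole_lt_trans phi0 hbm.
set u := unzip1 w in hL1 hL2 hL3 hw.
pose x0 k : R := \sum_(p <- w) (p.1 == k)%:R * p.2.
have x00 k : 0 <= x0 k.
  rewrite /x0 big_seq; apply: sumr_ge0 => p pw; apply: mulr_ge0 => //.
  by move/allP: w0; apply.
have x0w k : x0 k != 0 -> k \in u.
  apply: contraR => ku; rewrite /x0 big_seq big1 // => p pw; case: eqP => [E|_]; last by rewrite mul0r.
  by rewrite -E map_f in ku.
pose B := (\max_(k <- u) k).+1.
have uB k : k \in u -> (k < B)%N by move=> ku; rewrite ltnS; apply: (leq_bigmax_seq _ ku).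
have x0B : supp_lt B x0.
  move=> k Bk; apply/eqP; rewrite -[_ == _]negbK; apply/negP => /x0w /uB.
  by rewrite ltnNge Bk.
have prE f : pairing B f x0 = \sum_(p <- w) p.2 * f p.1.
  rewrite /pairing; transitivity (\sum_(k < B) \sum_(p <- w) f k * ((p.1 == k)%:R * p.2)).
    by apply: eq_bigr => k _; rewrite ger0_norm // mulr_sumr.
  rewrite exchange_big /= big_seq [RHS]big_seq; apply: eq_bigr => p pw.
  have pB := uB _ (map_f (fun p => p.1) pw).
  rewrite (bigD1 (Ordinal pB)) //= eqxx mul1r big1 ?addr0 1?mulrC // => k kp.
  case: eqP => [E|_]; last by rewrite mul0r mulr0.
  by move/eqP: kp; case; apply: val_inj.
have pr1 : pairing B (fun=> 1) x0 = 1.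
  by rewrite prE -[RHS]w1; apply: eq_bigr => p _; rewrite mulr1.
have Nle : N x0 <= 2 * c.
  apply: (mt_norm_le F_reg F_S0 theta01 x0B) => f hf; rewrite prE.
  pose P k := c < f k.
  apply: (@le_trans _ _ (weight P w + c)); last first.
    rewrite [2 * c]mulrDl !mul1r lerD2r; apply: hw; split.
      apply: (subseq_sorted ltn_trans _ hL1); apply: subseq_trans (filter_subseq _ _) _.
      exact: suffix_subseq.
    by exists f => // k; rewrite mem_filter => /andP[].
  have -> : weight P w + c = \sum_(p <- w) ((if P p.1 then p.2 else 0) + p.2 * c).
    by rewrite big_split /= -mulr_suml -/(weight predT w) w1 mul1r /weight big_mkcond.
  rewrite [leLHS]big_seq [leRHS]big_seq; apply: ler_sum => p pw.
  have p0 : 0 <= p.2 by move/allP: w0; apply.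
  case: ifPn => [_|/negbTE Pp].
    apply: (@le_trans _ _ p.2); last by rewrite lerDl mulr_ge0 // ltW.
    by rewrite -[leRHS]mulr1 ler_wpM2l // (norming_le1 theta01 _ hf).
  by rewrite add0r ler_wpM2l // leNgt -/(P p.1) Pp.
have u0 : (0 < size u)%N.
  rewrite lt0n size_map; apply/eqP => /size0nil wE; move: w1; rewrite wE /weight big_nil.
  by move/esym/eqP; rewrite oner_eq0.
have Npos : 0 < N x0.
  have Fu : F m [set` u].
    apply: (@F_closed m (s ++ u)); first exact: suffix_subseq.
    exact: (oiter_sub cb_deriv_sub hL3).
  have su : sorted ltn u by apply: (subseq_sorted ltn_trans _ hL1); apply: suffix_subseq.
  apply: lt_le_trans (norming_le F_reg F_S0 theta01 (norming_indicator m1 Fu su u0) x0B).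
  rewrite prE big_seq (eq_bigr (fun p => p.2 * theta m)); last first.
    by move=> p pw; rewrite map_f // mulr1.
  by rewrite -big_seq -mulr_suml -/(weight predT w) w1 mul1r.
have iN : 0 < (N x0)^-1 by rewrite invr_gt0.
exists (fun k => (N x0)^-1 * x0 k), u; split => //.
- by split => k; [rewrite mulr_ge0 // ltW|rewrite mulf_eq0 negb_or => /andP[_ /x0w]].
split.
  by rewrite (mt_normZ F_reg F_S0 theta01 iN x0B) mulVf // gt_eqF.
exists B; first by move=> k /x0B ->; rewrite mulr0.
rewrite pairingZ; last exact: ltW.
rewrite pr1 mulr1 ler_pdivlMr //.
apply: le_trans (ler_wpM2l _ Nle) _; first by rewrite divr_ge0 // ltW.
have ce : c * eps = theta m by rewrite divfK // gt_eqF.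
by lra.
Qed.

End Levels.

(** * Gluing normalized averages into large l^1 trees *)

Section Lower.
Variables (R : realType) (F : nat -> nfamily) (theta : nat -> R).
Hypothesis F_reg : forall n, regular (F n).
Hypothesis F_S0 : forall n, S0 `<=` F n.
Hypothesis theta01 : forall n, (1 <= n)%N -> 0 < theta n < 1.
Local Notation vec := (nat -> R).
Local Notation N := (mt_norm F theta).
Local Notation norming := (norming F theta).

Definition unit_vec (x : vec) : Prop :=
  [/\ finsupp x, forall k, 0 <= x k & N x = 1].

Definition precedes (x x' : vec) : bool :=
  `[< forall i j, x i != 0 -> x' j != 0 -> (i < j)%N >].

Lemma norm_disjoint_sum (t : seq vec) (c : nat -> R) k : {in t, forall x, unit_vec x} ->
  pairwise precedes t ->
  `|\sum_(i < size t) c i * nthv t i k| = \sum_(i < size t) `|c i| * nthv t i k.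
Proof.
move=> ht /(pairwiseP (fun=> 0)) pt.
have x0 (i : 'I_(size t)) : 0 <= nthv t i k.
  by have [_ h _] := ht (nthv t i) (mem_nth _ (ltn_ord i)).
have [[i xi]|h] := pselect (exists i : 'I_(size t), nthv t i k != 0).
  have z (j : 'I_(size t)) : j != i -> nthv t j k = 0.
    move=> ji; apply/eqP; rewrite -[_ == _]negbK; apply/negP => xj.
    have [ij|ij|ij] := ltngtP i j.
    - have /asboolP/(_ k k xi xj) := pt i j (ltn_ord i) (ltn_ord j) ij.
      by rewrite ltnn.
    - have /asboolP/(_ k k xj xi) := pt j i (ltn_ord j) (ltn_ord i) ij.
      by rewrite ltnn.
    - by move/eqP: ji; case; apply: val_inj.
  rewrite (bigD1 i) //= big1 ?addr0; last by move=> j /z ->; rewrite mulr0.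
  rewrite (bigD1 i) //= big1 ?addr0; last by move=> j /z ->; rewrite mulr0.
  by rewrite normrM (ger0_norm (x0 i)).
have z (j : 'I_(size t)) : nthv t j k = 0.
  by apply/eqP; rewrite -[_ == _]negbK; apply/negP => xj; apply: h; exists j.
by rewrite !big1 ?normr0 // => j _; rewrite z mulr0.
Qed.

(** One functional with value at least kap on every vector suffices: the vectors are disjoint and
    nonnegative, so the modulus of a combination is the combination with coefficients |c_i|. *)
Lemma l1K_of_norming (t : seq vec) f kap : 0 < kap -> norming f ->
  {in t, forall x, unit_vec x} -> pairwise precedes t ->
  {in t, forall x, exists2 B, supp_lt B x & kap <= pairing B f x} ->
  l1K_block N kap^-1 t.
Proof.
move=> kap0 hf ht pt hB; split.
- by move=> i isz; have [] := ht (nthv t i) (mem_nth _ isz).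
- move=> i j p q ij jsz xi xj.
  have /asboolP := (pairwiseP (fun=> 0) pt) i j (ltn_trans ij jsz) jsz ij.
  by apply.
move=> c; rewrite invrK.
have [B hBt] : exists B, {in t, forall x, supp_lt B x /\ kap <= pairing B f x}.
  elim: (t) hB => [|x t' IH] hB; first by exists 0%N.
  have [B1 hB1] := IH (fun y yt => hB y (mem_behead (s := x :: t') yt)).
  have [B2 s2 k2] := hB x (mem_head _ _).
  have wid B y : supp_lt B y /\ kap <= pairing B f y -> forall B', (B <= B')%N ->
      supp_lt B' y /\ kap <= pairing B' f y.
    move=> [h1 h2] B' BB'; split; first by move=> k kB; apply: h1; apply: leq_trans kB.
    by rewrite (pairing_widen _ BB').
  exists (maxn B1 B2) => y; rewrite inE => /orP[/eqP->|/hB1 hy].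
    by apply: (wid B2) => //; rewrite leq_maxr.
  by apply: (wid B1) => //; rewrite leq_maxl.
set z := (X in mt_norm _ _ X).
have zB : supp_lt B z.
  move=> k kB; rewrite /z big1 // => i _.
  by have [-> //] := hBt (nthv t i) (mem_nth _ (ltn_ord i)); rewrite mulr0.
apply: le_trans (norming_le F_reg F_S0 theta01 hf zB).
have -> : pairing B f z = \sum_(i < size t) `|c i| * pairing B f (nthv t i).
  rewrite /pairing; transitivity (\sum_(k < B) \sum_(i < size t) `|c i| * (f k * `|nthv t i k|)).
    apply: eq_bigr => k _; rewrite /z norm_disjoint_sum // mulr_sumr.
    apply: eq_bigr => i _; rewrite mulrCA; congr (_ * (_ * _)).
    by have [_ h _] := ht (nthv t i) (mem_nth _ (ltn_ord i)); rewrite ger0_norm.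
  by rewrite exchange_big; apply: eq_bigr => i _; rewrite mulr_sumr.
rewrite mulr_sumr; apply: ler_sum => i _; rewrite mulrC ler_wpM2l //.
by have [] := hBt (nthv t i) (mem_nth _ (ltn_ord i)).
Qed.

(** The empty list is kept as a possible root, from which derivatives are counted; [all_blocks1] is
    the tree proper. *)
Definition all_blocks (K : R) : set (seq vec) := [set t | l1K_block N K t].

Definition all_blocks1 (K : R) : set (seq vec) := [set t | (0 < size t)%N /\ l1K_block N K t].

Lemma l1K_block_take K t n : l1K_block N K t -> l1K_block N K (take n t).
Proof.
have [nt|nt] := ltnP n (size t); last by rewrite take_oversize.
move=> [h1 h2 h3]; have szE : size (take n t) = n by rewrite size_take nt.
have nE i : (i < n)%N -> nthv (take n t) i = nthv t i by move=> ?; rewrite /nthv nth_take.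
split; rewrite ?szE.
- by move=> i isz; rewrite nE //; apply: h1; apply: ltn_trans nt.
- move=> i j p q ij jsz; rewrite !nE //; last exact: ltn_trans jsz.
  by apply: h2 => //; apply: ltn_trans nt.
move=> c; have := h3 (fun i => if (i < n)%N then c i else 0).
have big_trunc (g : nat -> R -> R) : (forall i, g i 0 = 0) ->
    \sum_(i < size t) g i (if (i < n)%N then c i else 0) = \sum_(i < n) g i (c i).
  move=> g0; rewrite (big_ord_widen _ (fun i => g i (c i)) (ltnW nt)) [RHS]big_mkcond.
  by apply: eq_bigr => i _; case: ifP.
rewrite (big_trunc (fun _ r => `|r|)) ?normr0 //.
congr (_ <= N _); apply: funext => k.
rewrite (big_trunc (fun i r => r * nthv t i k)); last by move=> i; rewrite mul0r.
by apply: eq_bigr => i _; rewrite nE.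
Qed.

Lemma all_blocks1_tree K : l1K_tree N K (all_blocks1 K).
Proof.
split=> [t []|t n [t0 ht] n0 nt|t []] //; split; last exact: l1K_block_take.
by rewrite size_takel.
Qed.

Lemma oiter_all_blocks K d t : (0 < size t)%N -> oiter (@tree_deriv R) (all_blocks K) d t ->
  oiter (@tree_deriv R) (all_blocks1 K) d t.
Proof.
elim: d t => [|d IH|f IH] t t0 /=; first by [].
- move=> [/(IH t t0) h [u [hu tu ut]]]; split => //; exists u; split => //.
  by apply: IH => //; apply: leq_trans tu.
- by move=> h n; apply: IH.
Qed.

(* [g] is a sum of functionals living on consecutive intervals [[p, q')] whose
   left endpoints are listed in [P]; [q] bounds what has been used so far. *)
Inductive cert : seq nat -> nat -> vec -> Prop :=
| cert0 : cert [::] 0%N (fun=> 0)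
| certS P q g p q' f : cert P q g -> (q <= p)%N -> (p < q')%N -> norming f ->
    cert (rcons P p) q'
      (fun k => if (k < q)%N then g k else if (p <= k < q')%N then f k else 0).

Lemma cert_rep P q g : cert P q g -> exists Es fs, [/\ size Es = size P,
  forall i, (i < size Es)%N -> [/\ finite_set (nth set0 Es i),
    is_min_of (nth set0 Es i) (nth 0%N P i), norming (fs i) &
    forall k, nth set0 Es i k -> (k < q)%N],
  forall i j k l, (i < j)%N -> (j < size Es)%N ->
    nth set0 Es i k -> nth set0 Es j l -> (k < l)%N &
  forall k, g k = \sum_(i < size Es) (k \in nth set0 Es i)%:R * fs i k].
Proof.
elim=> {P q g} [|P q g p q' f _ [Es [fs [szE hE disj gE]]] qp pq' hf].
  by exists [::], (fun _ _ => 0); split => // k; rewrite big_ord0.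
pose I := [set k | (p <= k < q')%N].
have nI i : (i < size Es)%N -> nth set0 (rcons Es I) i = nth set0 Es i.
  by move=> isz; rewrite nth_rcons isz.
have nL : nth set0 (rcons Es I) (size Es) = I by rewrite nth_rcons ltnn eqxx.
exists (rcons Es I), (fun i => if (i < size Es)%N then fs i else f); split.
- by rewrite !size_rcons szE.
- move=> i; rewrite size_rcons ltnS leq_eqVlt => /orP[/eqP->|isz].
    rewrite nL ltnn nth_rcons szE ltnn eqxx; split => //.
    + by apply: sub_finite_set (finite_II q') => k /= /andP[].
    + by split; rewrite /I /= ?leqnn // => k /andP[].
    + by move=> k /andP[].
  have [h1 h2 h3 h4] := hE i isz; rewrite nI // isz nth_rcons -szE isz; split => //.
  by move=> k /h4 kq; apply: leq_trans kq (leq_trans qp (ltnW pq')).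
- move=> i j k l ij; rewrite size_rcons ltnS leq_eqVlt => /orP[/eqP jE|jsz].
    rewrite jE nL in ij *; rewrite nI //; have [_ _ _ h4] := hE i ij.
    by move=> /h4 kq /andP[pl _]; apply: leq_trans kq (leq_trans qp pl).
  by rewrite !nI //; [apply: disj|apply: ltn_trans jsz].
move=> k; rewrite size_rcons big_ord_recr /= nL ltnn.
have -> : \sum_(i < size Es) (k \in nth set0 (rcons Es I) i)%:R *
    (if (i < size Es)%N then fs i else f) k = g k.
  by rewrite gE; apply: eq_bigr => i _; rewrite nI // ltn_ord.
have [kq|kq] := ltnP k q.
  rewrite memNset ?mul0r ?addr0 // => /andP[pk _].
  by move: (leq_trans qp pk); rewrite leqNgt kq.
have -> : g k = 0.
  rewrite gE big1 // => i _; rewrite memNset ?mul0r // => Ek.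
  by have [_ _ _ /(_ k Ek)] := hE i (ltn_ord i); rewrite ltnNge kq.
rewrite add0r; case: ifPn => hk; first by rewrite mem_set // mul1r.
by rewrite memNset ?mul0r //; apply/negP.
Qed.

(** The entries of P are the minima of the intervals carrying g, so P in F_n makes these intervals
    admissible. *)
Lemma cert_norming n P q g : (1 <= n)%N -> cert P q g -> (0 < size P)%N -> F n [set` P] ->
  norming (fun k => theta n * g k).
Proof.
move=> n1 /cert_rep[Es [fs [szE hE disj gE]]] P0 FP.
have -> : (fun k => theta n * g k) = step_fun theta n Es fs.
  by apply: funext => k; rewrite gE.
apply: norming_step => //; last by move=> i /hE[].
split => //; first by rewrite szE.
  by move=> i /hE[h1 [h2 _] _ _]; split => // E; rewrite E in h2.
have [_ hF _ _] := F_reg n; apply: hF FP _ => m [i isz [mE mm]] /=.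
have [_ [h1 h2] _ _] := hE i isz.
have -> : m = nth 0%N P i by apply/eqP; rewrite eqn_leq mm //= h2.
by apply: mem_nth; rewrite -szE.
Qed.

Section Outer.
Variables (xi : Ord) (eps : R) (n : nat).
Hypothesis eps0 : 0 < eps.
Hypothesis n1 : (1 <= n)%N.
Hypothesis xi0 : ~ ole xi OZ.
Hypothesis select : forall b, olt b (opow xi) -> exists m eta bm, [/\ (1 <= m)%N,
  oiter cb_deriv (F m) (omul (opow eta) (opow b)) set0,
  olt bm (opow eta) & ranked (level F theta (theta m / eps)) bm].
Local Notation a := (opow (opow xi)).
Let kap := eps / 2.
Let K := (theta n * kap)^-1.

(** Induction on zeta, the order still available to P in F_n. One successor step opens a new
    interval with left endpoint p and gains order a, through inner trees of order omega^b that all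
    work with the same kap. *)
Lemma outer_tree zeta t P q g : cert P q g -> sorted ltn P ->
  oiter cb_deriv (F n) zeta [set` P] -> {in t, forall x, unit_vec x} ->
  pairwise precedes t -> {in t, forall x, supp_lt q x /\ kap <= pairing q g x} ->
  oiter (@tree_deriv R) (all_blocks K) (omul a zeta) t.
Proof.
have kap0 : 0 < kap by rewrite divr_gt0.
have tn0 := theta_gt0 theta01 n1.
have nF m := regular_near (F_reg m).
elim: zeta t P q g => [|zeta IH|f IH] t P q g cP sP FP ht pt hq.
- have tk0 : 0 < theta n * kap by rewrite mulr_gt0.
  (* Without intervals g is 0, and kap > 0 forces t to be empty. *)
  case: P cP sP FP => [|p P] cP sP FP.
    have t0 : t = [::].
      case: (t) hq => // x t' hq; have [_] := hq x (mem_head _ _).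
      have -> : g = fun=> 0 by inversion cP => //; case: (P) H => [|? ?] /(congr1 size); rewrite size_rcons.
      rewrite /pairing big1 ?leNgt ?kap0 // => k _; by rewrite mul0r.
    rewrite t0; apply: (@l1K_of_norming _ (fun k => (k \in set0)%:R)) => //.
    by apply: norming_base; apply: F_nil.
  apply: (l1K_of_norming tk0 (cert_norming n1 cP _ FP)) => // x xt.
  have [h1 h2] := hq x xt; exists q => //.
  have -> : pairing q (fun k => theta n * g k) x = theta n * pairing q g x.
    by rewrite /pairing mulr_sumr; apply: eq_bigr => k _; rewrite mulrA.
  by rewrite ler_wpM2l // ltW.
(* It is enough to gain omega^b for each b below omega^xi, and every b may use its own m. *)
- apply: oiter_limit.
    apply: (IH _ _ _ _ cP) => //.
    by apply: (oiter_anti cb_deriv_sub cb_deriv_mono (ole_S zeta)).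
  move=> rho /(olt_opow_opow xi0)[b hb rb].
  apply: (oiter_anti (@tree_deriv_sub R) (@tree_deriv_mono R) (ole_add2l _ rb)).
  have [m [eta [bm [m1 hm hbm rkm]]]] := select hb.
  have [p [qp sPp FPp]] := oiter_cb_grow q (nF n) sP FP.
  have tm0 := theta_gt0 theta01 m1.
  (* The set s in F_m supports the vectors u chosen so far in the new interval, and rho' is the
     order left to s in units of omega^eta. *)
  suff inner rho' s u : sorted ltn s -> {in s, forall k, (p <= k)%N} ->
      oiter cb_deriv (F m) (omul (opow eta) rho') [set` s] ->
      {in u, forall x, unit_vec x /\ (forall k, x k != 0 -> k \in s)} ->
      {in u, forall x, exists2 B, supp_lt B x & kap <= theta m * pairing B (fun=> 1) x} ->
      pairwise precedes u ->
      oiter (@tree_deriv R) (all_blocks K) (oadd (omul a zeta) rho') (t ++ u).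
    by rewrite -[t]cats0; apply: (inner _ [::]); rewrite ?set_nil.
  elim: rho' s u => [|rho' IHr|f IHr] s u ss sp Fs hu hBu pu.
  (* No inner order is left: the interval from p to q' is closed with a functional equal to theta_m
     on s, which has value at least kap on each vector of u. *)
  + pose q' := (\max_(k <- p :: s) k).+1.
    have q'k k : k \in p :: s -> (k < q')%N.
      by move=> ks; rewrite ltnS; apply: (leq_bigmax_seq _ ks).
    have pq' : (p < q')%N by apply: q'k; rewrite mem_head.
    have [f hf fE] : exists2 f, norming f & {in s, forall k, f k = theta m}.
      case: (posnP (size s)) => [/size0nil s0|s0].
        exists (fun k => (k \in set0)%:R); last by rewrite s0.
        by apply: norming_base; apply: F_nil.
      exists (fun k => theta m * (k \in s)%:R); last by move=> k ->; rewrite mulr1.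
      apply: (norming_indicator _ F_reg F_S0 m1 _ ss s0).
      exact: (oiter_sub cb_deriv_sub Fs).
    apply: (IH _ _ _ _ (certS cP qp pq' hf)) => //.
    * by move=> x; rewrite mem_cat => /orP[/ht//|/hu[]].
    * rewrite pairwise_cat pt pu !andbT; apply/allrelP => x y xt yu.
      apply/asboolP => i j xi_ yj; have [hx _] := hq x xt; have [_ hy] := hu y yu.
      have iq : (i < q)%N by rewrite ltnNge; apply/negP => /hx E; rewrite E eqxx in xi_.
      exact: leq_trans iq (leq_trans qp (sp _ (hy _ yj))).
    move=> x; rewrite mem_cat => /orP[xt|xu].
      have [hx1 hx2] := hq x xt; have qq' : (q <= q')%N by apply: leq_trans qp (ltnW pq').
      split; first by move=> k kq; apply: hx1; apply: leq_trans kq.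
      rewrite (pairing_widen _ qq' hx1); apply: le_trans hx2 _.
      by apply: ler_sum => k _; rewrite ltn_ord.
    have [_ xs] := hu x xu; have [B hB hk] := hBu x xu.
    have hx : supp_lt q' x.
      move=> k kq; apply/eqP; rewrite -[_ == _]negbK; apply/negP => /xs ks.
      by move: kq; rewrite leqNgt q'k // inE ks orbT.
    split => //; apply: le_trans hk _.
    have -> : pairing B (fun=> 1) x = pairing q' (fun=> 1) x.
      rewrite -(pairing_widen _ (leq_maxl B q') hB).
      by rewrite -(pairing_widen _ (leq_maxr B q') hx).
    rewrite /pairing mulr_sumr; apply: ler_sum => k _.
    have [->|xk] := eqVneq (x k) 0; first by rewrite normr0 !mulr0.
    have ks := xs _ xk; rewrite mul1r ltnNge (leq_trans qp (sp _ ks)) /=.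
    by rewrite (sp _ ks) ltn_ord /= fE.
  + split.
      apply: (IHr s) => //.
      exact: (oiter_anti cb_deriv_sub cb_deriv_mono (ole_mul2l _ (ole_S rho'))).
    have [x [w [sw pw Fw [x0 xw] [Nx hB]]]] :=
      normalized_average F_reg F_S0 theta01 eps0 p m1 hbm rkm ss Fs.
    exists (t ++ rcons u x); split; last 2 first.
    * by rewrite !size_cat size_rcons addnS.
    * by rewrite -rcons_cat -cats1 take_size_cat.
    apply: (IHr (s ++ w)) => //.
    * by move=> k; rewrite mem_cat => /orP[/sp|/pw].
    * move=> y; rewrite mem_rcons inE => /orP[/eqP->|/hu[h1 h2]]; last first.
        by split => // k /h2 ks; rewrite mem_cat ks.
      split; last by move=> k /xw kw; rewrite mem_cat kw orbT.
      by split => //; have [B /lt_finsupp] := hB.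
    * by move=> y; rewrite mem_rcons inE => /orP[/eqP->|/hBu].
    rewrite pairwise_rcons pu andbT; apply/allP => y yu; apply/asboolP => i j yi xj.
    have [_ ys] := hu y yu.
    move: sw; rewrite sorted_pairwise; last exact: ltn_trans.
    by rewrite pairwise_cat => /and3P[/allrelP h _ _]; apply: h; [apply: ys|apply: xw].
  + by move=> i; apply: (IHr i s) => //; exact: (Fs i).
- by move=> i; apply: (IH i _ _ _ _ cP) => //; exact: (FP i).
Qed.

End Outer.
End Lower.

Theorem theorem16 (R : realType) (F : nat -> nfamily) (theta : nat -> R)
  (alpha : nat -> Ord) (xi : Ord) :
  (forall n, regular (F n)) ->
  (forall n, S0 `<=` F n) ->
  regular (\bigcup_n F n) ->
  (forall n, (1 <= n)%N -> 0 < theta n < 1) ->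
  (forall n, (1 <= n)%N -> theta n.+1 <= theta n) ->
  theta @ \oo --> (0 : R) ->
  (forall n, iota_is (F n) (alpha n)) ->
  (forall n, (1 <= n)%N -> olt oone (alpha n)) ->
  (forall n, (1 <= n)%N -> ole (alpha n) (alpha n.+1)) ->
  ~ ole xi OZ ->
  oeq (OL (fun n => alpha n.+1)) (opow (opow xi)) ->
  (forall n, olt (alpha n) (opow (opow xi))) ->
  (exists eps : R, 0 < eps /\
     forall beta, olt beta (opow xi) ->
       exists m, (1 <= m)%N /\ exists g L,
         [/\ gamma_is alpha theta eps m g, ell_is (alpha m) L &
             olt (oadd (oadd g otwo) beta) L]) ->
  Ib_is (mt_norm F theta) (opow (omul (opow xi) otwo)).
Proof.
move=> F_reg F_S0 _ theta01 theta_dec theta_cvg F_iota alpha_gt1 alpha_S xi0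
  alpha_sup alpha_lt [eps [eps0 gap]].
have theta_le_1st n : (1 <= n)%N -> theta n <= theta 1%N.
  elim: n => [//|[//|n] IH] _; exact: le_trans (theta_dec n.+1 isT) (IH isT).
have alpha_mono m n : (1 <= m)%N -> (m <= n)%N -> ole (alpha m) (alpha n).
  move=> m1 /subnKC <-; elim: (n - m)%N => [|k IH]; first by rewrite addn0.
  by rewrite addnS; apply: ole_trans IH (alpha_S _ _); apply: leq_trans m1 (leq_addr _ _).
have theta_small (e : R) : 0 < e ->
    exists2 M, (1 <= M)%N & forall n, (M <= n)%N -> theta n < e.
  move=> e0; move/cvgrPdist_lt: theta_cvg => /(_ e e0)[M _ hM].
  exists M.+1 => // n Mn; have := hM n (ltnW Mn); rewrite /= sub0r normrN.
  by move=> h; apply: le_lt_trans (ler_norm _) h.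
split; first by move=> K T; apply: upper_bound.
have -> : opow (omul (opow xi) otwo) = omul (opow (opow xi)) (opow (opow xi)).
  by rewrite /= oadd0l opowD.
move=> d hd.
(* The order a * a is the supremum of the orders a * alpha_n with n >= 1, so d lies below one of
   them; the constant may depend on this n. *)
have [n hn] : exists n, olt d (omul (opow (opow xi)) (alpha n.+1)).
  by apply: olt_OL_inv; apply: olt_le_trans hd (ole_mul2l _ alpha_sup.2).
have sel := selection F_reg F_S0 theta01 theta_le_1st theta_small F_iota alpha_gt1
  alpha_mono xi0 alpha_lt eps0 gap.
have := @outer_tree R F theta F_reg F_S0 theta01 xi eps n.+1 eps0 isT xi0 sel
  (alpha n.+1) [::] [::] 0%N _ (cert0 F theta).
set K := (theta n.+1 * (eps / 2))^-1.
have K0 : 0 < K by rewrite invr_gt0 mulr_gt0 ?divr_gt0 // (theta_gt0 theta01).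
rewrite set_nil F_iota => /(_ isT erefl) hnil.
have {}hnil : oiter (@tree_deriv R) (all_blocks F theta K) (omul (opow (opow xi)) (alpha n.+1)) [::].
  by apply: hnil.
(* The root survives stage d + 1, so it has a proper extension surviving stage d; being nonempty,
   this extension belongs to the tree without root. *)
have [_ [u [hu u0 _]]] := oiter_anti (@tree_deriv_sub R) (@tree_deriv_mono R) hn hnil.
exists K, (all_blocks1 F theta K); split => //; first exact: all_blocks1_tree.
by exists u; apply: oiter_all_blocks.
Qed.
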